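(* The global modal standard Łukasiewicz logic $\vdash_{K\text{Ł}}$ is not axiomatizable.
   Context: The standard MV algebra $[0,1]_{\text{Ł}}$ is the real unit interval with its usual order (lattice operations $\min,\max$), $a\cdot b=\max\{0,a+b-1\}$, $a\rightarrow b=\min\{1,1-a+b\}$, constants $0,1$, and $\neg a=a\rightarrow 0$. Modal formulas (set $Fm$) are built from a countable set $\mathcal{V}$ of propositional variables using $\wedge,\vee,\cdot,\rightarrow,\neg,\overline{0},\overline{1}$ and unary $\Box,\Diamond$. A standard Łukasiewicz Kripke model is $\mathfrak{M}=\langle W,R,e\rangle$ with $W\neq\emptyset$, $R\subseteq W\times W$ and $e:W\times\mathcal{V}\to[0,1]$, extended to formulas by interpreting propositional connectives and constants world-wise in $[0,1]_{\text{Ł}}$ and $e(v,\Box\varphi)=\inf_{Rvw}e(w,\varphi)$, $e(v,\Diamond\varphi)=\sup_{Rvw}e(w,\varphi)$ (with $\inf\emptyset=1$, $\sup\emptyset=0$). $K\text{Ł}$ is the class of all these models. $\mathfrak{M}\models\varphi$ means $e(v,\varphi)=1$ for all $v\in W$; similarly for sets. For finite $\Gamma\cup\{\varphi\}\subseteq Fm$, $\Gamma\vdash_{K\text{Ł}}\varphi$ means that every $\mathfrak{M}\in K\text{Ł}$ with $\mathfrak{M}\models\Gamma$ satisfies $\mathfrak{M}\models\varphi$. For arbitrary $\Gamma$, $\Gamma\vdash_{K\text{Ł}}\varphi$ means $\Gamma_0\vdash_{K\text{Ł}}\varphi$ for some finite $\Gamma_0\subseteq\Gamma$. A rule is a pair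 $\langle\Gamma,\varphi\rangle\in\mathcal{P}(Fm)\times Fm$, finitary if $\Gamma$ is finite. A logic is a set of rules that is reflexive ($\langle\Gamma,\gamma\rangle$ for $\gamma\in\Gamma$), closed under cut (if $\langle\Gamma,\phi\rangle$ is in it for all $\phi\in\Phi$ and $\langle\Phi,\varphi\rangle$ is in it, then so is $\langle\Gamma,\varphi\rangle$) and closed under substitutions. A set of rules $R$ axiomatizes a logic if that logic is the smallest logic containing $R$. A logic is axiomatizable if it is axiomatized by some recursive set of finitary rules. *)

(* Defs.v *)
From HB Require Import structures.
From mathcomp Require Import all_boot all_order all_algebra.
From mathcomp Require Import all_classical all_reals.

Set Implicit Arguments.
Unset Strict Implicit.
Unset Printing Implicit Defensive.

Import Order.TTheory GRing.Theory Num.Theory.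

Local Open Scope classical_set_scope.

(* [Fus] is the monoidal conjunction, written with a dot on paper. *)
Inductive fm : Type :=
| Var of nat
| And of fm & fm
| Or of fm & fm
| Fus of fm & fm
| Imp of fm & fm
| Neg of fm
| Bot
| Top
| Box of fm
| Dia of fm.

HB.instance Definition _ := gen_eqMixin fm.
HB.instance Definition _ := gen_choiceMixin fm.

Fixpoint subst (s : nat -> fm) (a : fm) : fm :=
  match a with
  | Var p => s p
  | And b c => And (subst s b) (subst s c)
  | Or b c => Or (subst s b) (subst s c)
  | Fus b c => Fus (subst s b) (subst s c)
  | Imp b c => Imp (subst s b) (subst s c)
  | Neg b => Neg (subst s b)
  | Bot => Bot
  | Top => Top
  | Box b => Box (subst s b)
  | Dia b => Dia (subst s b)
  end.

Section Semantics.
Local Open Scope ring_scope.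
Variable R : realType.

Definition luk_mul (a b : R) : R := Num.max 0 (a + b - 1).
Definition luk_imp (a b : R) : R := Num.min 1 (1 - a + b).
Definition luk_neg (a : R) : R := luk_imp a 0.

(* Bounds in the lattice [0,1], of subsets of [0,1]; the library's [inf] and
   [sup] of the empty set of reals are both 0. *)
Definition luk_inf (A : set R) : R := if pselect (A = set0) then 1 else inf A.
Definition luk_sup (A : set R) : R := if pselect (A = set0) then 0 else sup A.

Record model : Type := Model {
  world : Type;
  world_inhabited : inhabited world;
  acc : world -> world -> Prop;
  atom : world -> nat -> R;
  atom_bounds : forall w p, 0 <= atom w p <= 1
}.

Fixpoint value (M : model) (v : world M) (a : fm) : R :=
  match a with
  | Var p => atom v p
  | And b c => Num.min (value v b) (value v c)
  | Or b c => Num.max (value v b) (value v c)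
  | Fus b c => luk_mul (value v b) (value v c)
  | Imp b c => luk_imp (value v b) (value v c)
  | Neg b => luk_neg (value v b)
  | Bot => 0
  | Top => 1
  | Box b => luk_inf [set value w b | w in [set w | acc v w]]
  | Dia b => luk_sup [set value w b | w in [set w | acc v w]]
  end.

Definition valid_in (M : model) (a : fm) : Prop :=
  forall v : world M, value v a = 1.

Definition entails (G : set fm) (a : fm) : Prop :=
  forall M : model, (forall g, G g -> valid_in M g) -> valid_in M a.

End Semantics.

Definition rule : Type := (set fm * fm)%type.

(* [entails] itself need not be compact, so the finite subset matters; for
   finite [r.1] this is [entails R r.1 r.2]. *)
Definition KL (R : realType) : set rule :=
  [set r | exists G0 : set fm,
     [/\ finite_set G0, G0 `<=` r.1 & entails R G0 r.2]].

Definition finitary (r : rule) : Prop := finite_set r.1.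

Record is_logic (L : set rule) : Prop := IsLogic {
  logic_refl : forall (G : set fm) g, G g -> L (G, g);
  logic_cut : forall (G D : set fm) a,
    (forall d, D d -> L (G, d)) -> L (D, a) -> L (G, a);
  logic_subst : forall (s : nat -> fm) (G : set fm) a,
    L (G, a) -> L (subst s @` G, subst s a)
}.

(* [smallest C X] is the intersection of all sets containing [X] and
   satisfying [C]; logics are closed under intersection. *)
Definition axiomatizes (X L : set rule) : Prop := L = smallest is_logic X.

(* Kleene's partial recursive functions, indexed by their arity. *)
Inductive recfun : nat -> Type :=
| RZero : recfun 0
| RSucc : recfun 1
| RProj n (i : 'I_n) : recfun n
| RComp k n (f : recfun k) (g : 'I_k -> recfun n) : recfun n
| RPrec n (f : recfun n) (g : recfun n.+2) : recfun n.+1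
| RMu n (f : recfun n.+1) : recfun n.

(* [computes f xs y]: [f] is defined at [xs], with value [y].  The recursion
   argument of [RPrec] and the search argument of [RMu] come first; in [RPrec]
   the function [h] lists the successive values of the recursion. *)
Fixpoint computes n (f : recfun n) : n.-tuple nat -> nat -> Prop :=
  match f in recfun n return n.-tuple nat -> nat -> Prop with
  | RZero => fun _ y => y = 0
  | RSucc => fun xs y => y = (thead xs).+1
  | RProj _ i => fun xs y => y = tnth xs i
  | RComp k _ f g => fun xs y =>
      exists2 ys : k.-tuple nat,
        forall i, computes (g i) xs (tnth ys i) & computes f ys y
  | RPrec n f g => fun xs y =>
      let xs' : n.-tuple nat := [tuple of behead xs] in
      exists h : nat -> nat,
        [/\ computes f xs' (h 0),
            forall m, m < thead xs ->
              computes g [tuple of m :: h m :: xs'] (h m.+1)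
          & y = h (thead xs)]
  | RMu _ f => fun xs y =>
      computes f [tuple of y :: xs] 0 /\
      forall z, z < y -> exists u, computes f [tuple of z :: xs] u.+1
  end.

Definition recursive (A : set nat) : Prop :=
  exists f : recfun 1, forall n : nat,
    (A n -> computes f [tuple n] 1) /\ (~ A n -> computes f [tuple n] 0).

(* The Cantor pairing function. *)
Definition cpair (m n : nat) : nat := ((m + n) * (m + n).+1)./2 + n.

Fixpoint code_fm (a : fm) : nat :=
  match a with
  | Var p => cpair 0 p
  | And b c => cpair 1 (cpair (code_fm b) (code_fm c))
  | Or b c => cpair 2 (cpair (code_fm b) (code_fm c))
  | Fus b c => cpair 3 (cpair (code_fm b) (code_fm c))
  | Imp b c => cpair 4 (cpair (code_fm b) (code_fm c))
  | Neg b => cpair 5 (code_fm b)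
  | Bot => cpair 6 0
  | Top => cpair 7 0
  | Box b => cpair 8 (code_fm b)
  | Dia b => cpair 9 (code_fm b)
  end.

Fixpoint code_seq (s : seq fm) : nat :=
  if s is a :: s' then (cpair (code_fm a) (code_seq s')).+1 else 0.

Definition code_rule (s : seq fm) (a : fm) : nat :=
  cpair (code_seq s) (code_fm a).

(* A finitary rule is coded through every list enumerating its premises. *)
Definition recursive_rules (X : set rule) : Prop :=
  recursive [set n | exists s a, n = code_rule s a /\ X ([set` s], a)].

Definition axiomatizable (L : set rule) : Prop :=
  exists X : set rule,
    [/\ X `<=` finitary, recursive_rules X & axiomatizes X L].

(* Main.v *)
(* Finite entailment is not recursively enumerable, by diagonalization.  Let
   [u] be a letter whose value is constant along a Kripke model.  Multiples of
   [u] represent natural numbers, and [Neg u -> x] adds one to [x].  A world can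
   therefore carry an instance of a Horn clause over the naturals, its arguments
   being the values of letters, and its successors can carry instances proving
   the atoms of the clause body.  A clock growing by [u] along the edges, and
   bounded by 1, makes this tree well-founded as soon as [u] is positive.  Hence a Horn
   system derives an atom iff some model of its encoding gives [u] a positive
   value at a world carrying that atom, that is, iff an entailment FAILS.
   Conversely, if a recursive set of rules axiomatizes the logic, then finite
   entailment is itself defined by a Horn program.  Applied to its own encoding,
   the program derives that the diagonal entailment holds iff it fails. *)
From HB Require Import structures.
Require Import Defs.
From mathcomp Require Import all_boot all_order all_algebra.
From mathcomp Require Import all_classical all_reals.
From mathcomp Require Import zify lra.

Set Implicit Arguments.
Unset Strict Implicit.
Unset Printing Implicit Defensive.

Import Order.TTheory GRing.Theory Num.Theory.
Local Open Scope classical_set_scope.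

(** * Pairing and decoding *)

Lemma cpair_step m n : cpair m n.+1 = (cpair m.+1 n).+1.
Proof. by rewrite /cpair addnS addSn addnS. Qed.

Lemma cpair_base n : cpair n.+1 0 = (cpair 0 n).+1.
Proof.
rewrite /cpair !addn0 add0n.
have -> : n.+1 * n.+2 = n * n.+1 + n.+1.*2 by lia.
by rewrite halfD odd_double andbF add0n doubleK addnS.
Qed.

(** The move of Cantor's walk along the antidiagonals: by [cpair_step] and [cpair_base] it raises
    the code by one. *)
Definition unpair_next (p : nat * nat) : nat * nat :=
  if p.1 is m.+1 then (m, p.2.+1) else (p.2.+1, 0).

Definition unpair (n : nat) : nat * nat := iter n unpair_next (0, 0).

Lemma unpairK n : cpair (unpair n).1 (unpair n).2 = n.
Proof.
elim: n => [//|n IHn]; rewrite /unpair iterS -/(unpair n).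
case: (unpair n) IHn => [[|m] k] /= <-; first exact: cpair_base.
exact: cpair_step.
Qed.

Lemma cpairK m n : unpair (cpair m n) = (m, n).
Proof.
move: {1 3}(cpair m n) (erefl (cpair m n)) => k.
elim: k m n => [|k IHk] [|m] [|n] //; rewrite ?cpair_step ?cpair_base //.
- by move=> [] /IHk; rewrite /unpair iterS -/(unpair k) => ->.
- by move=> [] /IHk; rewrite /unpair iterS -/(unpair k) => ->.
- by move=> [] /IHk; rewrite /unpair iterS -/(unpair k) => ->.
Qed.

Lemma cpair_inj m n m' n' : cpair m n = cpair m' n' -> m = m' /\ n = n'.
Proof. by move/(congr1 unpair); rewrite !cpairK => -[]. Qed.

Lemma leq_cpair m n : m + n <= cpair m n.
Proof.
rewrite /cpair; case: m => [|m]; first by rewrite add0n leq_addl.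
rewrite leq_add2r; have : 2 * m.+1 <= (m.+1 + n) * (m.+1 + n).+1 by nia.
by move/half_leq; rewrite mul2n doubleK.
Qed.

Global Opaque cpair.
Arguments cpair : simpl never.

Fixpoint code_list (l : seq nat) : nat :=
  if l is a :: l' then (cpair a (code_list l')).+1 else 0.

Lemma code_list_surj n : exists l, code_list l = n.
Proof.
elim/ltn_ind: n => -[|n] IHn; first by exists [::].
have := leq_cpair (unpair n).1 (unpair n).2; rewrite unpairK => le_n.
have [|l El] := IHn (unpair n).2; first by lia.
by exists ((unpair n).1 :: l); rewrite /= El unpairK.
Qed.

Lemma code_list_inj : injective code_list.
Proof.
elim=> [|a l IHl] [|b l'] //= [] /cpair_inj[-> /IHl->] //.
Qed.

Definition to_list (n : nat) : seq nat := xget [::] [set l | code_list l = n].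

Lemma to_listK : cancel to_list code_list.
Proof. by move=> n; exact: xgetPex (code_list_surj n). Qed.

Lemma code_listK : cancel code_list to_list.
Proof. by move=> l; apply: code_list_inj; rewrite to_listK. Qed.

Lemma to_list0 : to_list 0 = [::].
Proof. exact: (code_listK [::]). Qed.

Lemma to_listS a n : to_list (cpair a n).+1 = a :: to_list n.
Proof. by rewrite -{1}(to_listK n) -[(_).+1]/(code_list (a :: _)) code_listK. Qed.

Lemma code_seqE s : code_seq s = code_list (map code_fm s).
Proof. by elim: s => //= a s ->. Qed.

(* Numbers that code no formula are decoded as well, so that the relations on
   codes below need no well-formedness condition. *)
Fixpoint to_fm_fuel (k n : nat) : fm :=
  if k is k'.+1 then
    let: (t, m) := unpair n in
    let f := to_fm_fuel k' in
    match t with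
    | 0 => Var m
    | 1 => And (f (unpair m).1) (f (unpair m).2)
    | 2 => Or (f (unpair m).1) (f (unpair m).2)
    | 3 => Fus (f (unpair m).1) (f (unpair m).2)
    | 4 => Imp (f (unpair m).1) (f (unpair m).2)
    | 5 => Neg (f m)
    | 6 => Bot
    | 7 => Top
    | 8 => Box (f m)
    | 9 => Dia (f m)
    | _ => Bot
    end
  else Bot.

Definition to_fm (n : nat) : fm := to_fm_fuel n.+1 n.

(** Recursive calls occur only under nonzero tags, where [leq_cpair] makes the argument strictly
    smaller, so any two amounts of fuel above [n] agree. *)
Lemma to_fm_fuelE k n : n < k -> to_fm_fuel k n = to_fm n.
Proof.
rewrite /to_fm; move: {2 4}n.+1 (ltnSn n) => k'.
elim: k n k' => [//|k IHk] n [//|k'] lt_k' lt_k /=.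
have := leq_cpair (unpair n).1 (unpair n).2; rewrite unpairK.
case: (unpair n) => -[//|t] m /= le_n.
have := leq_cpair (unpair m).1 (unpair m).2; rewrite unpairK => le_m.
by do 9?[case: t le_n => [|t] le_n]; rewrite 2?(IHk _ k') //; lia.
Qed.

Lemma to_fmE t m : to_fm (cpair t m) =
  match t with
  | 0 => Var m
  | 1 => And (to_fm (unpair m).1) (to_fm (unpair m).2)
  | 2 => Or (to_fm (unpair m).1) (to_fm (unpair m).2)
  | 3 => Fus (to_fm (unpair m).1) (to_fm (unpair m).2)
  | 4 => Imp (to_fm (unpair m).1) (to_fm (unpair m).2)
  | 5 => Neg (to_fm m)
  | 6 => Bot
  | 7 => Top
  | 8 => Box (to_fm m)
  | 9 => Dia (to_fm m)
  | _ => Bot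
  end.
Proof.
rewrite {1}/to_fm /= cpairK; case: t => [//|t].
have := leq_cpair t.+1 m => le_n.
have := leq_cpair (unpair m).1 (unpair m).2; rewrite unpairK => le_m.
by do 9?[case: t le_n => [|t] le_n]; rewrite 2?to_fm_fuelE //; lia.
Qed.

Lemma code_fmK : cancel code_fm to_fm.
Proof.
by elim=> //=; do ?[move=> b IHb c IHc | move=> b IHb | move=> ?];
   rewrite to_fmE ?cpairK /= ?IHb ?IHc.
Qed.

(** * Horn systems *)

Definition clause (T : Type) : Type := (seq T * seq (seq T))%type.

(* An atom is the list of a predicate symbol, itself a number, and its arguments;
   [eval] evaluates terms in an environment. *)
Inductive derivable (T : Type) (eval : (nat -> nat) -> T -> nat)
    (H : seq (clause T)) : seq nat -> Prop :=
  Derivable (rho : nat -> nat) (j : nat) :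
    j < size H ->
    (forall i, i < size (nth ([::], [::]) H j).2 ->
       derivable eval H (map (eval rho) (nth [::] (nth ([::], [::]) H j).2 i))) ->
    derivable eval H (map (eval rho) (nth ([::], [::]) H j).1).

(** The terms that modal formulas can express directly, successor being [Incr] below. Pairing,
    allowed in [term], is compiled away by [flat]. *)
Inductive pterm : Type := PVar of nat | PConst of nat | PSucc of pterm.

Inductive term : Type :=
| TVar of nat
| TConst of nat
| TSucc of term
| TPair of term & term.

HB.instance Definition _ := gen_eqMixin pterm.
HB.instance Definition _ := gen_choiceMixin pterm.
HB.instance Definition _ := gen_eqMixin term.
HB.instance Definition _ := gen_choiceMixin term.

Fixpoint eval_pterm (rho : nat -> nat) (t : pterm) : nat :=
  match t with
  | PVar v => rho v
  | PConst n => n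
  | PSucc t => (eval_pterm rho t).+1
  end.

Fixpoint eval_term (rho : nat -> nat) (t : term) : nat :=
  match t with
  | TVar v => rho v
  | TConst n => n
  | TSucc t => (eval_term rho t).+1
  | TPair t s => cpair (eval_term rho t) (eval_term rho s)
  end.

Fixpoint code_term (t : term) : nat :=
  match t with
  | TVar v => cpair 0 v
  | TConst n => cpair 1 n
  | TSucc t => cpair 2 (code_term t)
  | TPair t s => cpair 3 (cpair (code_term t) (code_term s))
  end.

Lemma code_term_inj : injective code_term.
Proof.
elim=> [v|v|t IH|t IHt s IHs] [v'|v'|t'|t' s'] /= /cpair_inj[] //.
- by move=> _ ->.
- by move=> _ ->.
- by move=> _ /IH ->.
- by move=> _ /cpair_inj[/IHt -> /IHs ->].
Qed.

(* A pair is replaced by a fresh variable, named after the pair, which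
   [pair_atoms] constrains. *)
Fixpoint flat (t : term) : pterm :=
  match t with
  | TVar v => PVar (code_term t)
  | TConst n => PConst n
  | TSucc s => PSucc (flat s)
  | TPair _ _ => PVar (code_term t)
  end.

Fixpoint pair_atoms (t : term) : seq (seq pterm) :=
  match t with
  | TSucc s => pair_atoms s
  | TPair s1 s2 => [:: PConst 1; flat s1; flat s2; flat t]
                     :: pair_atoms s1 ++ pair_atoms s2
  | _ => [::]
  end.

Definition clause_terms (c : clause term) : seq term := c.1 ++ flatten c.2.

Definition flat_clause (c : clause term) : clause pterm :=
  (map flat c.1,
   map (map flat) c.2 ++ flatten (map pair_atoms (clause_terms c))).

(** These clauses retrace the antidiagonal walk: its start, a move inside an antidiagonal, and the
    jump to the next one. *)
Definition pair_clauses : seq (clause pterm) :=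
  let x := PVar 0 in let y := PVar 1 in let z := PVar 2 in
  [:: ([:: PConst 1; PConst 0; PConst 0; PConst 0], [::]);
      ([:: PConst 1; x; PSucc y; PSucc z], [:: [:: PConst 1; PSucc x; y; z]]);
      ([:: PConst 1; PSucc x; PConst 0; PSucc y],
       [:: [:: PConst 1; PConst 0; x; y]])].

Definition flat_system (H : seq (clause term)) : seq (clause pterm) :=
  pair_clauses ++ map flat_clause H.

Definition clause_arity (T : Type) (n : nat) (c : clause T) : bool :=
  (size c.1 == n) && all (fun b => size b == n) c.2.

Lemma flat_system_arity H :
  all (clause_arity 4) H -> all (clause_arity 4) (flat_system H).
Proof.
move=> /= /allP H4; rewrite all_map; apply/allP => c /H4 /andP[c1 c2].
rewrite /clause_arity /= size_map c1 all_cat all_map /=.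
apply/andP; split.
  by apply: sub_all c2 => b /=; rewrite size_map.
elim: (clause_terms c) => //= t l IHl; rewrite all_cat IHl andbT.
by elim: t => //= t IHt s IHs; rewrite all_cat IHt IHs.
Qed.

Definition models (T : Type) (eval : (nat -> nat) -> T -> nat)
    (I : seq nat -> Prop) (c : clause T) : Prop :=
  forall rho, (forall i, i < size c.2 -> I (map (eval rho) (nth [::] c.2 i))) ->
  I (map (eval rho) c.1).

Lemma derivable_sound (T : Type) (eval : (nat -> nat) -> T -> nat) H I a :
  (forall j, j < size H -> models eval I (nth ([::], [::]) H j)) ->
  derivable eval H a -> I a.
Proof. by move=> HI; elim=> rho j lt_j _ IH; apply: HI. Qed.

Lemma nth_cat_addn (T : Type) (x : T) s1 s2 i :
  nth x (s1 ++ s2) (size s1 + i) = nth x s2 i.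
Proof. by rewrite nth_cat ltnNge leq_addr /= addKn. Qed.

Lemma eval_flat rho t :
  (forall i, i < size (pair_atoms t) ->
     exists x y, map (eval_pterm rho) (nth [::] (pair_atoms t) i)
                 = [:: 1; x; y; cpair x y]) ->
  eval_pterm rho (flat t) = eval_term (fun v => rho (code_term (TVar v))) t.
Proof.
elim: t => [v|n|t IHt|t IHt s IHs] //= Ht; first by rewrite IHt.
have [x [y /= [Ex Ey ->]]] := Ht 0 isT.
rewrite -{}Ex -{}Ey IHt ?IHs // => i lt_i.
- have := Ht (size (pair_atoms t) + i).+1.
  rewrite /= nth_cat_addn; apply.
  by rewrite size_cat ltnS ltn_add2l.
- have := Ht i.+1; rewrite /= nth_cat lt_i; apply.
  by rewrite size_cat ltnS ltn_addr.
Qed.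

(** Semantic, because flattened derivations also use predicate 1, which [I] has to read as the graph
    of [cpair]. A flattened clause then follows from its original, since its pair atoms force the
    fresh variables to equal the pairs that they name. *)
Lemma flat_sound H I a :
  (forall z x y, I [:: 1; x; y; z] <-> z = cpair x y) ->
  (forall j, j < size H -> models eval_term I (nth ([::], [::]) H j)) ->
  derivable eval_pterm (flat_system H) a -> I a.
Proof.
move=> Ipair HI; apply: derivable_sound => j.
rewrite size_cat /=; case: j => [|[|[|j]]] lt_j rho /= Hb.
- by apply/Ipair.
- by apply/Ipair; move/Ipair: (Hb 0 isT) => /= ->; rewrite cpair_step.
- by apply/Ipair; move/Ipair: (Hb 0 isT) => /= ->; rewrite cpair_base.
move: lt_j Hb; rewrite !ltnS size_map => lt_j.
rewrite (nth_map ([::], [::])) //; set c := nth _ H j => Hb.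
have flatE t : t \in clause_terms c ->
    eval_pterm rho (flat t) = eval_term (fun v => rho (code_term (TVar v))) t.
  move=> tc; apply: eval_flat => i lt_i.
  have : nth [::] (pair_atoms t) i \in flatten (map pair_atoms (clause_terms c)).
    by apply/flatten_mapP; exists t => //; apply: mem_nth.
  set a' := nth _ _ _ => a'_in.
  have Ia' : I (map (eval_pterm rho) a').
    (* The pair atoms come after the [size c.2] original body atoms. *)
    have := Hb (size c.2 + index a' (flatten (map pair_atoms (clause_terms c)))).
    rewrite /= size_cat -[in size c.2 + index _ _](size_map (map flat)).
    by rewrite ltn_add2l index_mem nth_cat_addn nth_index //; apply.
  have [x [y [z Ea']]] : exists x y z, a' = [:: PConst 1; x; y; z].
    rewrite /a'; elim: t {tc a' a'_in Ia'} i lt_i => //= t IHt s IHs [|i] lt_i.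
      by do 3?eexists.
    rewrite /= nth_cat; case: ltnP => lt_i'; first exact: IHt.
    by apply: IHs; move: lt_i; rewrite ltnS size_cat; lia.
  move: Ia'; rewrite Ea' /= => /Ipair ->.
  by do 2?eexists.
rewrite /= -map_comp.
rewrite (eq_in_map _ (eval_term (fun v => rho (code_term (TVar v)))) c.1).1; last first.
  by move=> t tc; apply: flatE; rewrite mem_cat tc.
apply: HI => // i lt_i.
have := Hb i; rewrite /= size_cat size_map ltn_addr // nth_cat size_map lt_i.
rewrite (nth_map [::]) // -map_comp => /(_ isT).
rewrite (eq_in_map _ (eval_term (fun v => rho (code_term (TVar v)))) _).1 // => t tc.
apply: flatE; rewrite mem_cat; apply/orP; right.
by apply/flattenP; exists (nth [::] c.2 i) => //; apply: mem_nth.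
Qed.

Lemma derivable_nth (T : Type) (eval : (nat -> nat) -> T -> nat) H rho j a :
  j < size H ->
  (forall i, i < size (nth ([::], [::]) H j).2 ->
     derivable eval H (map (eval rho) (nth [::] (nth ([::], [::]) H j).2 i))) ->
  a = map (eval rho) (nth ([::], [::]) H j).1 ->
  derivable eval H a.
Proof. by move=> lt_j Hb ->; apply: Derivable. Qed.

(** By induction on the code: each pair clause with a body lowers it by one. *)
Lemma derivable_pair H x y :
  derivable eval_pterm (flat_system H) [:: 1; x; y; cpair x y].
Proof.
move: {2}(cpair x y) (erefl (cpair x y)) => n.
elim: n x y => [|n IHn] x [|y].
- case: x => [|x]; first by move=> _; apply: (derivable_nth (rho := id) (j := 0)).
  by rewrite cpair_base.
- by rewrite cpair_step.
- case: x => [|x]; rewrite ?cpair_base // => -[] /IHn dn.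
  pose rho k := nth 0 [:: x; cpair 0 x] k.
  by apply: (derivable_nth (rho := rho) (j := 2)) => // -[].
- rewrite cpair_step => -[] /IHn dn.
  pose rho k := nth 0 [:: x; y; cpair x.+1 y] k.
  by apply: (derivable_nth (rho := rho) (j := 1)) => // -[].
Qed.

Lemma flat_complete H a :
  derivable eval_term H a -> derivable eval_pterm (flat_system H) a.
Proof.
elim=> {a} rho j lt_j _; set c := nth _ H j => IHb.
(* The variable numbered [code_term t] receives the value of [t]; the default only concerns numbers
   that code no term. *)
pose sigma v := eval_term rho (xget (TConst 0) [set t | code_term t = v]).
have sigmaE t : sigma (code_term t) = eval_term rho t.
  rewrite /sigma; congr (eval_term rho _); apply: code_term_inj.
  exact: xgetPex (ex_intro [set s | code_term s = code_term t] t (erefl _)).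
have flatE t : eval_pterm sigma (flat t) = eval_term rho t.
  elim: t => [v|n|t IHt|t IHt s IHs] /=.
  - by rewrite (sigmaE (TVar v)).
  - by [].
  - by rewrite IHt.
  - by rewrite (sigmaE (TPair t s)).
have pairs t i : i < size (pair_atoms t) ->
    derivable eval_pterm (flat_system H) (map (eval_pterm sigma) (nth [::] (pair_atoms t) i)).
  elim: t i => //= t IHt s IHs [_|i]; last first.
    rewrite /= size_cat ltnS nth_cat => lt_i; case: ltnP => [|le_i].
      exact: IHt.
    by apply: IHs; lia.
  by rewrite /= !flatE (sigmaE (TPair t s)); apply: derivable_pair.
(* The shift skips the three [pair_clauses]. *)
have Ec : nth ([::], [::]) (flat_system H) (j + 3) = flat_clause c.
  by rewrite /flat_system nth_cat /= addnK addn3 /= (nth_map ([::], [::])).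
apply: (derivable_nth (rho := sigma) (j := j + 3)); last first.
- by rewrite Ec /= -map_comp; apply: eq_map => t /=; rewrite flatE.
- rewrite Ec /= => i; rewrite size_cat size_map nth_cat size_map.
  case: (ltnP i (size c.2)) => [lt_i _|lt_i].
    rewrite (nth_map [::]) // -map_comp.
    by under eq_map => t do rewrite /= flatE; apply: IHb.
  have {}lt_i : i = size c.2 + (i - size c.2) by rewrite subnKC.
  rewrite [X in X < _]lt_i ltn_add2l; move: (i - _) => {lt_i} {}i lt_i.
  set a := nth _ _ _; have : a \in flatten (map pair_atoms (clause_terms c)).
    exact: mem_nth.
  case/flatten_mapP=> t _ a_t; rewrite -(nth_index [::] a_t).
  by apply: pairs; rewrite index_mem.
- by rewrite size_cat size_map /= addnC ltn_add2l.
Qed.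

(** * Encoding of Horn systems by modal formulas *)

Definition Iff (a b : fm) : fm := And (Imp a b) (Imp b a).
Definition Crisp (a : fm) : fm := Or a (Neg a).
Definition Conj (l : seq fm) : fm := foldr And Top l.
Definition Disj (l : seq fm) : fm := foldr Or Bot l.

(** * Formula values in Łukasiewicz models *)

Section LukasiewiczValues.
Local Open Scope ring_scope.
Variables (R : realType) (M : model R).
Implicit Types (v w : world M) (a b : fm).

Lemma luk_inf_le (A : set R) x :
  (forall y, A y -> 0 <= y) -> A x -> luk_inf A <= x.
Proof.
move=> A0 Ax; rewrite /luk_inf; case: pselect => /= [A_0|_].
  by move: Ax; rewrite A_0.
by apply: ge_inf => //; exists 0.
Qed.

Lemma luk_sup_ge (A : set R) x :
  (forall y, A y -> y <= 1) -> A x -> x <= luk_sup A.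
Proof.
move=> A1 Ax; rewrite /luk_sup; case: pselect => /= [A_0|_].
  by move: Ax; rewrite A_0.
by apply: ub_le_sup => //; exists 1.
Qed.

Lemma luk_inf_ge (A : set R) x :
  x <= 1 -> (forall y, A y -> x <= y) -> x <= luk_inf A.
Proof.
move=> x1 Ax; rewrite /luk_inf; case: pselect => //= /eqP/set0P A0.
exact: lb_le_inf.
Qed.

Lemma luk_sup_le (A : set R) x :
  0 <= x -> (forall y, A y -> y <= x) -> luk_sup A <= x.
Proof.
move=> x1 Ax; rewrite /luk_sup; case: pselect => //= /eqP/set0P A0.
exact: ge_sup.
Qed.

Lemma luk_impE (x y : R) : luk_imp x y = Num.min 1 (1 - x + y).
Proof. by []. Qed.

Lemma luk_imp_bounds (x y : R) :
  0 <= x <= 1 -> 0 <= y <= 1 -> 0 <= luk_imp x y <= 1.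
Proof. by move=> /andP[? ?] /andP[? ?]; rewrite luk_impE; case: (leP 1 (1 - x + y)) => ?; lra. Qed.

Lemma value_bounds v a : 0 <= value v a <= 1.
Proof.
elim: a v => //=.
- by move=> p v; apply: atom_bounds.
- by move=> b IHb c IHc v; case: (leP (value v b)).
- by move=> b IHb c IHc v; case: (leP (value v b)).
- move=> b IHb c IHc v; rewrite /luk_mul.
  by move: (IHb v) (IHc v) => /andP[? ?] /andP[? ?]; case: (leP 0 (value v b + value v c - 1)) => ?; lra.
- by move=> b IHb c IHc v; apply: luk_imp_bounds.
- by move=> b IHb v; apply: luk_imp_bounds => //; lra.
- by move=> v; lra.
- by move=> v; lra.
- move=> b IHb v; apply/andP; split.
    by apply: luk_inf_ge => // _ [w _ <-]; have /andP[] := IHb w.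
  rewrite /luk_inf; case: pselect => //= /eqP/set0P[x Ax].
  have : luk_inf [set value w b | w in [set w | acc v w]] <= x.
    by apply: luk_inf_le => // _ [w _ <-]; have /andP[] := IHb w.
  rewrite /luk_inf; case: pselect => /= [A0|_]; first by move: Ax; rewrite A0.
  by move: Ax => [w _ <-] /le_trans; apply; have /andP[] := IHb w.
- move=> b IHb v; apply/andP; split; last first.
    by apply: luk_sup_le => // _ [w _ <-]; have /andP[] := IHb w.
  rewrite /luk_sup; case: pselect => //= /eqP/set0P[x Ax].
  have : x <= luk_sup [set value w b | w in [set w | acc v w]].
    by apply: luk_sup_ge => // _ [w _ <-]; have /andP[] := IHb w.
  rewrite /luk_sup; case: pselect => /= [A0|_]; first by move: Ax; rewrite A0.
  by apply: le_trans; move: Ax => [w _ <-]; have /andP[] := IHb w.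
Qed.

Lemma value_ge0 v a : 0 <= value v a.
Proof. by have /andP[] := value_bounds v a. Qed.

Lemma value_le1 v a : value v a <= 1.
Proof. by have /andP[] := value_bounds v a. Qed.

Lemma holds_And v a b :
  value v (And a b) = 1 <-> value v a = 1 /\ value v b = 1.
Proof.
have := value_le1 v a; have := value_le1 v b => b1 a1 /=.
by case: leP => ?; (split; first by move=> ?; split; lra); case; lra.
Qed.

Lemma holds_Imp v a b : value v (Imp a b) = 1 <-> value v a <= value v b.
Proof. by rewrite /= luk_impE; case: (leP 1) => ?; split => ?; lra. Qed.

Lemma holds_Iff v a b : value v (Iff a b) = 1 <-> value v a = value v b.
Proof.
rewrite holds_And !holds_Imp; split=> [[ab ba]|->]; last by split.
by apply/eqP; rewrite eq_le ab.
Qed.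

Lemma value_Neg v a : value v (Neg a) = 1 - value v a.
Proof.
by move: (value_ge0 v a) => ?; rewrite /= /luk_neg luk_impE; case: leP => ?; lra.
Qed.

Lemma holds_Crisp v a :
  value v (Crisp a) = 1 <-> value v a = 0 \/ value v a = 1.
Proof.
have /andP[a0 a1] := value_bounds v a.
rewrite /Crisp /= -/(value v (Neg a)) value_Neg; case: leP => ?; split; try (by move=> ?; left; lra).
- by case; lra.
- by move=> ?; right; lra.
- by case; lra.
Qed.

Lemma holds_Conj v l :
  value v (Conj l) = 1 <-> (forall a, a \in l -> value v a = 1).
Proof.
elim: l => [|a l IHl]; first by split.
rewrite -[Conj _]/(And a (Conj l)) holds_And IHl; split.
  by move=> [va vl] b; rewrite inE => /orP[/eqP->|/vl].
by move=> al; split=> [|b bl]; apply: al; rewrite inE ?eqxx ?bl ?orbT.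
Qed.

Lemma holds_Disj v l :
  value v (Disj l) = 1 <-> (exists2 a, a \in l & value v a = 1).
Proof.
elim: l => [|a l IHl]; first by split=> [/=|[]//]; lra.
rewrite -[Disj _]/(Or a (Disj l)) /=.
have := value_le1 v a; have := value_le1 v (Disj l) => dl1 a1.
split=> [|[b]].
  case: leP => _.
    by move/IHl => [b bl vb]; exists b => //; rewrite inE bl orbT.
  by exists a => //; rewrite inE eqxx.
rewrite inE => /orP[/eqP-> va|bl vb].
  by case: (leP (value v a) (value v (Disj l))) => ?; lra.
have -> : value v (Disj l) = 1 by apply/IHl; exists b.
by case: leP => ?; lra.
Qed.

Lemma value_Box_le v w a : acc v w -> value v (Box a) <= value w a.
Proof.
by move=> vw; apply: luk_inf_le; [move=> _ [? _ <-]; apply: value_ge0 | exists w].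
Qed.

Lemma value_Dia_ge v w a : acc v w -> value w a <= value v (Dia a).
Proof.
by move=> vw; apply: luk_sup_ge; [move=> _ [? _ <-]; apply: value_le1 | exists w].
Qed.

Lemma value_Box_ge v a x :
  x <= 1 -> (forall w, acc v w -> x <= value w a) -> x <= value v (Box a).
Proof.
by move=> x1 xP; apply: luk_inf_ge => // _ [w vw <-]; apply: xP.
Qed.

Lemma value_Dia_le v a x :
  0 <= x -> (forall w, acc v w -> value w a <= x) -> value v (Dia a) <= x.
Proof.
by move=> x0 xP; apply: luk_sup_le => // _ [w vw <-]; apply: xP.
Qed.

(** In general a supremum equal to 1 need not be attained. For a crisp formula it is: otherwise
    every successor gives 0, and so does the supremum. *)
Lemma crisp_Dia v a :
  (forall w, value w a = 0 \/ value w a = 1) ->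
  value v (Dia a) = 1 -> exists2 w, acc v w & value w a = 1.
Proof.
move=> a01 /eqP; apply: contraPP => no_w; apply/negP.
rewrite lt_eqF // (@le_lt_trans _ _ 0) //.
apply: value_Dia_le => // w vw; case: (a01 w) => [->//|wa].
by case: no_w; exists w.
Qed.

(* When [a] is crisp and holds at some successor, this says that [b] has, at
   every successor where [a] holds, the value that [c] has here. *)
Definition Link (a b c : fm) : fm :=
  And (Iff (Box (Imp a b)) c) (Iff (Dia (And a b)) c).

Lemma value_Imp1 v a b : value v a = 1 -> value v (Imp a b) = value v b.
Proof.
move=> va; rewrite /= luk_impE va; have := value_le1 v b.
by case: (leP 1) => ? ?; lra.
Qed.

Lemma value_And1 v a b : value v a = 1 -> value v (And a b) = value v b.
Proof.
by move=> va /=; rewrite va; have := value_le1 v b; case: (leP 1) => ? ?; lra.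
Qed.

Lemma value_Imp0 v a b : value v a = 0 -> value v (Imp a b) = 1.
Proof.
move=> va; rewrite /= luk_impE va; have := value_ge0 v b.
by case: (leP 1) => ? ?; lra.
Qed.

Lemma value_And0 v a b : value v a = 0 -> value v (And a b) = 0.
Proof.
by move=> va /=; rewrite va; have := value_ge0 v b; case: (leP 0) => ? ?; lra.
Qed.

Lemma holds_Imp1 v a b :
  value v a = 1 -> value v (Imp a b) = 1 -> value v b = 1.
Proof. by move=> /value_Imp1 ->. Qed.

(** Where [a] holds, [b] lies between the infimum of [Imp a b] and the supremum of [And a b], and
    the link equates both with [c]. *)
Lemma holds_Link_inv v w a b c :
  value v (Link a b c) = 1 -> acc v w -> value w a = 1 ->
  value w b = value v c.
Proof.
move=> /holds_And[/holds_Iff cB /holds_Iff cD] vw wa.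
apply/eqP; rewrite eq_le; apply/andP; split.
  by rewrite -cD -(value_And1 b wa) value_Dia_ge.
by rewrite -cB -(value_Imp1 b wa) value_Box_le.
Qed.

(** Successors where [a] is 0 contribute 1 to the infimum and 0 to the supremum, hence change
    neither; [w] attains both. *)
Lemma holds_Link v w a b c :
  acc v w -> value w a = 1 ->
  (forall w', acc v w' -> value w' a = 0 \/
     value w' a = 1 /\ value w' b = value v c) ->
  value v (Link a b c) = 1.
Proof.
move=> vw wa vwP; have wb : value w b = value v c.
  by case: (vwP w vw) => [|[]//]; rewrite wa; lra.
apply/holds_And; split; apply/holds_Iff/eqP; rewrite eq_le.
- apply/andP; split; first by rewrite -wb -(value_Imp1 b wa) value_Box_le.
  apply: value_Box_ge => [|w' vw']; first exact: value_le1.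
  case: (vwP w' vw') => [w'a|[w'a <-]]; last by rewrite value_Imp1.
  by rewrite value_Imp0 // value_le1.
- apply/andP; split; last by rewrite -wb -(value_And1 b wa) value_Dia_ge.
  apply: value_Dia_le => [|w' vw']; first exact: value_ge0.
  case: (vwP w' vw') => [w'a|[w'a <-]]; last by rewrite value_And1.
  by rewrite value_And0 // value_ge0.
Qed.

End LukasiewiczValues.

(* A number [n] is represented by the truth value [n * u], where [u] is the
   value of [unitV]. *)
Definition unitV : fm := Var (cpair 0 0).
Definition clockV : fm := Var (cpair 1 0).
Definition argV (s : nat) : fm := Var (cpair 2 s).
Definition childV (i : nat) : fm := Var (cpair 3 i).
Definition clauseV (j : nat) : fm := Var (cpair 4 j).
Definition envV (v : nat) : fm := Var (cpair 5 v).
Definition goalV : fm := Var (cpair 6 0).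

Definition Incr (a : fm) : fm := Imp (Neg unitV) a.
Definition Numeral (n : nat) : fm := iter n Incr Bot.

Fixpoint fm_of_pterm (t : pterm) : fm :=
  match t with
  | PVar v => envV v
  | PConst n => Numeral n
  | PSucc t => Incr (fm_of_pterm t)
  end.

(** [P] is [Iff] for a clause head, compared at the same world, and a [Link] for a body atom,
    compared at a successor. *)
Definition args_fm (P : fm -> fm -> fm) (L : nat) (b : seq pterm) : fm :=
  Conj [seq P (argV s) (fm_of_pterm (nth (PConst 0) b s)) | s <- iota 0 L].

Definition body_fm (L i : nat) (b : seq pterm) : fm :=
  And (Dia (childV i))
    (And (Link (childV i) unitV unitV)
       (And (Link (childV i) clockV (Incr clockV))
          (args_fm (Link (childV i)) L b))).

Definition clause_fm (L : nat) (c : clause pterm) : fm :=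
  And (args_fm Iff L c.1)
    (Conj [seq body_fm L i (nth [::] c.2 i) | i <- iota 0 (size c.2)]).

(** This leaves room to add one more unit to [a] without truncation. *)
Definition below_fm (a : fm) : fm := Imp a (Neg unitV).

(* At every world some clause flag holds, its head is the atom of the world,
   and each atom of its body is the atom of a successor.  The clock increases
   along the edges but stays below 1, so [unitV > 0] makes this well-founded. *)
Definition horn_fm (L : nat) (H : seq (clause pterm)) : fm :=
  Conj
    [:: Disj [seq clauseV j | j <- iota 0 (size H)];
        Conj [seq Imp (clauseV j) (clause_fm L (nth ([::], [::]) H j))
                | j <- iota 0 (size H)];
        Conj [seq Crisp (childV i)
                | i <- iota 0 (\max_(c <- H) size c.2)];
        below_fm clockV;
        Conj [seq below_fm (argV s) | s <- iota 0 L];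
        Crisp goalV;
        Conj [seq Imp goalV (Neg (argV s)) | s <- iota 0 L & s != 1]].

(** Kept apart from [horn_fm] because [n] will be the code of a rule with premise [horn_fm]. *)
Definition goal_fm (n : nat) : fm :=
  Imp goalV (Iff (argV 1) (Numeral n)).

(** As [goalV] is crisp, this fails exactly where [goalV] holds and the unit is positive. *)
Definition refuted_fm : fm := below_fm goalV.

(** * Soundness of the encoding *)

Section EncodingSound.
Local Open Scope ring_scope.
Variables (R : realType) (M : model R).
Implicit Types (v w : world M).

Lemma value_Incr w a : value w (Incr a) = Num.min 1 (value w unitV + value w a).
Proof.
have E := value_Neg w unitV; rewrite /Incr; move: E => /=.
by rewrite /luk_neg => ->; rewrite luk_impE; congr Num.min; lra.
Qed.

Lemma value_Incr_lt1 w a :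
  value w (Incr a) < 1 -> value w (Incr a) = value w unitV + value w a.
Proof.
rewrite value_Incr; move: (_ + _) => x.
by case: (leP 1 x) => // _; rewrite ltxx.
Qed.

(** In an arbitrary model the letters need not be multiples of the unit. Rounding down still
    commutes with adding a unit, by [readS]. *)
Definition read (u x : R) : nat := Num.trunc (x / u).

Lemma readS (u x : R) : 0 < u -> 0 <= x -> read u (u + x) = (read u x).+1.
Proof.
move=> u0 x0; rewrite /read mulrDl divff ?gt_eqF //.
have /truncn_itv : 0 <= x / u by rewrite divr_ge0 // ltW.
move=> /andP[]; rewrite -natr1 => ? ?; apply: truncn_def.
rewrite -2!natr1; lra.
Qed.

Lemma read_Num w n : 0 < value w unitV -> value w (Numeral n) < 1 ->
  read (value w unitV) (value w (Numeral n)) = n.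
Proof.
move=> u0; elim: n => [_|n IHn]; first by rewrite /read mul0r truncn0.
rewrite -[Numeral _.+1]/(Incr (Numeral n)) => lt1; have E := value_Incr_lt1 lt1; move: lt1; rewrite E => lt1.
by rewrite readS ?value_ge0 // IHn //; apply: le_lt_trans lt1; rewrite lerDr ltW.
Qed.

(** A value below 1 rules out truncation at every [Incr] in the term. *)
Lemma read_pterm w t : 0 < value w unitV -> value w (fm_of_pterm t) < 1 ->
  read (value w unitV) (value w (fm_of_pterm t)) =
  eval_pterm (fun i => read (value w unitV) (value w (envV i))) t.
Proof.
move=> u0; elim: t => [//|n|t IHt]; first exact: read_Num.
rewrite -[fm_of_pterm _]/(Incr (fm_of_pterm t)) => lt1; have E := value_Incr_lt1 lt1; move: lt1; rewrite E => lt1.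
by rewrite readS ?value_ge0 // IHt //; apply: le_lt_trans lt1; rewrite lerDr ltW.
Qed.

Variables (L : nat) (H : seq (clause pterm)).
Hypothesis H_arity : all (clause_arity L) H.
Hypothesis M_H : forall w, value w (horn_fm L H) = 1.

Definition world_atom w : seq nat :=
  mkseq (fun s => read (value w unitV) (value w (argV s))) L.

Lemma world_clause w :
  exists2 j, (j < size H)%N & value w (clause_fm L (nth ([::], [::]) H j)) = 1.
Proof.
have /holds_Conj wH := M_H w.
have /holds_Disj[_ /mapP[j jH ->] wj] := wH _ (mem_head _ _).
exists j; first by move: jH; rewrite mem_iota.
apply: (holds_Imp1 wj); move: j jH {wj}.
have /holds_Conj wC : value w (Conj
    [seq Imp (clauseV j) (clause_fm L (nth ([::], [::]) H j))
       | j <- iota 0 (size H)]) = 1.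
  by apply: wH; rewrite !inE eqxx !orbT.
by move=> j jH; apply: wC; apply: (map_f (fun j => Imp _ _)).
Qed.

Lemma world_arg_lt1 w s : (s < L)%N -> 0 < value w unitV ->
  value w (argV s) < 1.
Proof.
move=> sL u0; have /holds_Conj wH := M_H w.
have /holds_Conj wA : value w (Conj [seq below_fm (argV s) | s <- iota 0 L]) = 1.
  by apply: wH; rewrite !inE eqxx !orbT.
have /holds_Imp : value w (below_fm (argV s)) = 1.
  by apply: wA; apply: map_f; rewrite mem_iota.
by rewrite value_Neg; lra.
Qed.

Lemma world_clock w : value w clockV + value w unitV <= 1.
Proof.
have /holds_Conj wH := M_H w.
have /holds_Imp : value w (below_fm clockV) = 1.
  by apply: wH; rewrite !inE eqxx !orbT.
by rewrite value_Neg; lra.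
Qed.

Lemma child_crisp w j i :
  (j < size H)%N -> (i < size (nth ([::], [::]) H j).2)%N ->
  value w (childV i) = 0 \/ value w (childV i) = 1.
Proof.
move=> jH ij; apply/holds_Crisp; have /holds_Conj wH := M_H w.
have /holds_Conj : value w (Conj [seq Crisp (childV i)
    | i <- iota 0 (\max_(c <- H) size c.2)]) = 1.
  by apply: wH; rewrite !inE eqxx !orbT.
apply; apply: map_f; rewrite mem_iota add0n /=.
apply: leq_trans ij _.
by apply: (@leq_bigmax_seq _ H xpredT (fun c => size c.2)) => //; apply: mem_nth.
Qed.

Lemma args_fm_atom w (P : fm -> fm -> fm) b :
  size b = L -> value w (args_fm P L b) = 1 ->
  forall s, (s < L)%N ->
    value w (P (argV s) (fm_of_pterm (nth (PConst 0) b s))) = 1.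
Proof.
move=> bL /holds_Conj wb s sL; apply: wb.
by apply/mapP; exists s => //; rewrite mem_iota.
Qed.

Lemma mkseq_pev (x : nat -> R) (u : R) w b :
  size b = L -> u = value w unitV -> 0 < u ->
  (forall s, (s < L)%N -> x s < 1) ->
  (forall s, (s < L)%N -> x s = value w (fm_of_pterm (nth (PConst 0) b s))) ->
  mkseq (fun s => read u (x s)) L =
  map (eval_pterm (fun i => read (value w unitV) (value w (envV i)))) b.
Proof.
move=> bL -> u0 x1 xE; apply: (@eq_from_nth _ 0%N).
  by rewrite size_mkseq size_map.
rewrite size_mkseq => s sL; rewrite nth_mkseq // xE // read_pterm //.
  by rewrite (nth_map (PConst 0)) // bL.
by rewrite -xE // x1.
Qed.

Lemma encoding_sound w : 0 < value w unitV -> derivable eval_pterm H (world_atom w).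
Proof.
(* More than [1 / u] units: the clock gains one unit per edge and never exceeds 1, so the induction
   on [k] must end before 0. *)
move=> u0; pose k := (Num.trunc (value w unitV)^-1).+1.
have : 1 < value w clockV + k%:R * value w unitV.
  have /truncn_itv/andP[_] : 0 <= (value w unitV)^-1 by rewrite invr_ge0 ltW.
  rewrite -/k => ltk; have : (value w unitV)^-1 * value w unitV
    < k%:R * value w unitV by rewrite ltr_pM2r.
  rewrite mulVf ?gt_eqF // => {}ltk.
  by have := value_ge0 w clockV; lra.
clearbody k; elim: k w u0 => [|k IHk] w u0.
  by have := world_clock w; lra.
move=> ltk; have [j jH /holds_And[w_head /holds_Conj w_body]] := world_clause w.
have /andP[/eqP headL /allP bodyL] := all_nthP ([::], [::]) H_arity _ jH.
rewrite /world_atom (mkseq_pev headL (erefl _)) //.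
- apply: Derivable => // i ij.
  have bL : size (nth [::] (nth ([::], [::]) H j).2 i) = L.
    by apply/eqP/bodyL/mem_nth.
  have /holds_And[w_Dia /holds_And[w_u /holds_And[w_t w_args]]] :
      value w (body_fm L i (nth [::] (nth ([::], [::]) H j).2 i)) = 1.
    by apply: w_body; apply/mapP; exists i => //; rewrite mem_iota.
  have [w' ww' w'i] := crisp_Dia (fun w => child_crisp w jH ij) w_Dia.
  have w'u := holds_Link_inv w_u ww' w'i.
  have w't := holds_Link_inv w_t ww' w'i.
  have u'0 : 0 < value w' unitV by rewrite w'u.
  rewrite -(@mkseq_pev (fun s => value w' (argV s)) (value w' unitV)) //.
  (* The bound on the clock at [w] excludes truncation, so the clock gains a full unit and [k] can
     drop by one. *)
  + apply: IHk => //; rewrite w't w'u value_Incr.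
    have := world_clock w; rewrite addrC => /min_idPr ->.
    by move: ltk; rewrite -natr1; lra.
  + by move=> s sL; apply: world_arg_lt1.
  + by move=> s sL; apply: holds_Link_inv ww' w'i; apply: args_fm_atom w_args _ _.
- by move=> s sL; apply: world_arg_lt1.
- by move=> s sL; apply/holds_Iff; apply: args_fm_atom w_head _ _.
Qed.

Lemma refuted_derivable w n : (1 < L)%N ->
  value w (goal_fm n) = 1 -> value w refuted_fm <> 1 ->
  derivable eval_pterm H (mkseq (fun s => if s == 1%N then n else 0%N) L).
Proof.
move=> L1 w_goal w_ref; have /holds_Conj wH := M_H w.
have g01 : value w goalV = 0 \/ value w goalV = 1.
  by apply/holds_Crisp/wH; rewrite !inE eqxx !orbT.
have [g0|g1] := g01.
  by case: w_ref; apply/holds_Imp; rewrite g0 value_ge0.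
have u0 : 0 < value w unitV.
  rewrite lt_neqAle value_ge0 andbT; apply/eqP => u0; apply: w_ref.
  by apply/holds_Imp; rewrite value_Neg -u0 subr0 value_le1.
have := encoding_sound u0; congr derivable; apply/eq_in_map => s.
rewrite mem_iota add0n => /andP[_ sL]; cbv beta; case: eqP => [->|/eqP s1].
  have /holds_Iff E := holds_Imp1 g1 w_goal.
  by rewrite E read_Num // -E world_arg_lt1.
have /holds_Conj wA : value w
    (Conj [seq Imp goalV (Neg (argV s)) | s <- iota 0 L & s != 1%N]) = 1.
  by apply: wH; rewrite !inE eqxx !orbT.
have : value w (Neg (argV s)) = 1.
  apply: (holds_Imp1 g1); apply: wA; apply/mapP; exists s => //.
  by rewrite mem_filter s1 mem_iota.
rewrite value_Neg => A0; have -> : value w (argV s) = 0 by lra.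
by rewrite /read mul0r truncn0.
Qed.

End EncodingSound.

(** * Countermodels from derivations *)

Definition clause_nth (H : seq (clause pterm)) (j : nat) : clause pterm :=
  nth ([::], [::]) H j.

(* With heights and arguments bounded by [N], the unit [1 / N] represents all of
   them by truth values without truncation. *)
Inductive bounded_derivable (H : seq (clause pterm)) (N : nat) :
    nat -> seq nat -> Prop :=
  BoundedDerivable (rho : nat -> nat) (j k : nat) :
    j < size H ->
    all (fun x => x < N) (map (eval_pterm rho) (clause_nth H j).1) ->
    (forall i, i < size (clause_nth H j).2 ->
       bounded_derivable H N k (map (eval_pterm rho) (nth [::] (clause_nth H j).2 i))) ->
    bounded_derivable H N k.+1 (map (eval_pterm rho) (clause_nth H j).1).

Lemma bounded_derivable_mono H N k k' a :
  k <= k' -> bounded_derivable H N k a -> bounded_derivable H N k' a.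
Proof.
move=> kk' d; elim: d k' kk' => rho j {}k jH lt_N _ IH [//|k'] kk'.
by apply: BoundedDerivable => // i ij; apply: IH.
Qed.

(** [N] is quantified after [m], so that the subderivations can all be moved to one common [N]. *)
Lemma derivable_bounded H a : derivable eval_pterm H a ->
  exists m, forall N, m <= N -> bounded_derivable H N m a.
Proof.
elim=> rho j jH _ IH.
have /choice[m Hm] : forall i, exists m, i < size (clause_nth H j).2 ->
    forall N, m <= N -> bounded_derivable H N m
      (map (eval_pterm rho) (nth [::] (clause_nth H j).2 i)).
  move=> i.
  case: (ltnP i (size (clause_nth H j).2)) => [/IH[m Hm]|_]; first by exists m.
  by exists 0.
(* [m1] bounds the heights of the subderivations, [m2] the arguments of the head. *)
pose m1 := \max_(i < size (clause_nth H j).2) m i.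
pose m2 := \max_(x <- map (eval_pterm rho) (clause_nth H j).1) x.
exists (m1 + m2).+1 => N leN; apply: BoundedDerivable => //.
  apply/allP => x xc; apply: leq_trans leN; rewrite ltnS.
  by apply: leq_trans (leq_addl _ _); apply: (@leq_bigmax_seq _ _ xpredT id).
move=> i ij; have le_m1 : m i <= m1.
  exact: (@leq_bigmax _ (fun i : 'I__ => m i) (Ordinal ij)).
apply: (@bounded_derivable_mono _ _ (m i)); first by lia.
by apply: Hm => //; lia.
Qed.

Section Countermodel.
Local Open Scope ring_scope.
Variables (R : realType) (L : nat) (H : seq (clause pterm)).
Hypothesis H_arity : all (clause_arity L) H.
Variables (N : nat) (goal : seq nat).

(** A world is the last step of a bounded derivation, labelled with the position [node_child] of the
    body atom that it proves for a parent. All such steps are worlds, so no single derivation tree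
    has to be singled out. *)
Record node : Type := Node {
  node_env : nat -> nat;
  node_clause : nat;
  node_height : nat;
  node_child : nat;
  node_clauseP : (node_clause < size H)%N;
  node_heightP : (node_height < N)%N;
  node_headP : all (fun x => x < N)%N (map (eval_pterm node_env) (clause_nth H node_clause).1);
  node_bodyP : forall i, (i < size (clause_nth H node_clause).2)%N ->
    bounded_derivable H N node_height
      (map (eval_pterm node_env) (nth [::] (clause_nth H node_clause).2 i))
}.

Definition node_head (w : node) : seq nat :=
  map (eval_pterm (node_env w)) (clause_nth H (node_clause w)).1.

Definition node_body (w : node) : seq (seq nat) :=
  map (map (eval_pterm (node_env w))) (clause_nth H (node_clause w)).2.

Lemma bounded_derivable_node k a i : (k <= N)%N -> bounded_derivable H N k a ->
  exists w, [/\ node_head w = a, k = (node_height w).+1 & node_child w = i].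
Proof.
move=> kN d; case: d kN => rho j {}k jH lt_N body kN.
by exists (Node i jH kN lt_N body).
Qed.

(** Heights are only upper bounds, so a successor can be required to lie exactly one below; the
    clock then grows by exactly one unit along each edge. *)
Definition node_acc (w w' : node) : Prop :=
  [/\ node_height w = (node_height w').+1, (node_child w' < size (node_body w))%N
    & node_head w' = nth [::] (node_body w) (node_child w')].

(** Environments may take values above [N]; truncation keeps them in the unit interval and, by
    [scaledS], commutes with adding a unit. *)
Definition scaled (n : nat) : R := Num.min 1 (n%:R / N%:R).

(** The tags are those of the letters [unitV] to [goalV]. The clock runs against the height and ends
    at [N - 1] units, one short of 1. *)
Definition node_atom (w : node) (p : nat) : R :=
  let: (k, m) := unpair p in
  match k with
  | 0 => scaled 1
  | 1 => scaled (N - (node_height w).+1)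
  | 2 => scaled (nth 0%N (node_head w) m)
  | 3 => (node_child w == m)%:R
  | 4 => (node_clause w == m)%:R
  | 5 => scaled (node_env w m)
  | _ => (node_head w == goal)%:R
  end.

Lemma scaled_bounds n : 0 <= scaled n <= 1.
Proof.
have n0 : 0 <= n%:R / N%:R :> R by rewrite divr_ge0.
by rewrite /scaled; case: (leP 1 (n%:R / N%:R)) => ?; apply/andP; split; lra.
Qed.

Lemma node_atom_bounds w p : 0 <= node_atom w p <= 1.
Proof.
rewrite /node_atom; case: (unpair p) => k m; have b01 (b : bool) : 0 <= (b%:R : R) <= 1.
  by case: b; rewrite ?lexx ler01.
by do 6?[case: k => [|k]]; rewrite ?scaled_bounds ?b01.
Qed.

Variable root : node.

Definition countermodel : model R :=
  Model (inhabits root) node_acc node_atom_bounds.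

Implicit Types w : world countermodel.

Lemma value_unitV w : value w unitV = scaled 1.
Proof. by rewrite /= /node_atom cpairK. Qed.

Lemma value_clockV w : value w clockV = scaled (N - (node_height w).+1).
Proof. by rewrite /= /node_atom cpairK. Qed.

Lemma value_argV w s : value w (argV s) = scaled (nth 0%N (node_head w) s).
Proof. by rewrite /= /node_atom cpairK. Qed.

Lemma value_childV w i : value w (childV i) = (node_child w == i)%:R.
Proof. by rewrite /= /node_atom cpairK. Qed.

Lemma value_clauseV w j : value w (clauseV j) = (node_clause w == j)%:R.
Proof. by rewrite /= /node_atom cpairK. Qed.

Lemma value_envV w v : value w (envV v) = scaled (node_env w v).
Proof. by rewrite /= /node_atom cpairK. Qed.

Lemma value_goalV w : value w goalV = (node_head w == goal)%:R.
Proof. by rewrite /= /node_atom cpairK. Qed.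

Lemma N_gt0 : 0 < N%:R :> R.
Proof. by rewrite ltr0n; exact: leq_ltn_trans (leq0n _) (node_heightP root). Qed.

Lemma scaled_small n : (n <= N)%N -> scaled n = n%:R / N%:R.
Proof.
move=> nN; apply/min_idPr; rewrite ler_pdivrMr ?N_gt0 // mul1r.
by rewrite ler_nat.
Qed.

Lemma scaledS n : Num.min 1 (scaled 1 + scaled n) = scaled n.+1.
Proof.
have N0 := N_gt0; rewrite (@scaled_small 1) -?(ltr0n R) // mulr1n.
rewrite /scaled -natr1 mulrDl !mul1r.
have n0 : 0 <= n%:R / N%:R :> R by rewrite divr_ge0.
have N1 : 0 <= N%:R^-1 :> R by rewrite invr_ge0 ltW.
case: (leP 1 (n%:R / N%:R)) => h; last by rewrite addrC.
by rewrite !(min_idPl _) //; lra.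
Qed.

Lemma value_Incr_scaled w a n :
  value w a = scaled n -> value w (Incr a) = scaled n.+1.
Proof. by move=> wa; rewrite value_Incr wa value_unitV scaledS. Qed.

Lemma value_Numeral w n : value w (Numeral n) = scaled n.
Proof.
elim: n => [|n IHn]; last exact: value_Incr_scaled.
by rewrite scaled_small // mul0r.
Qed.

Lemma value_pterm w t : value w (fm_of_pterm t) = scaled (eval_pterm (node_env w) t).
Proof.
elim: t => [v|n|t IHt]; first exact: value_envV.
  exact: value_Numeral.
exact: value_Incr_scaled.
Qed.

Lemma below_scaled w a n : (n < N)%N -> value w a = scaled n ->
  value w (below_fm a) = 1.
Proof.
move=> nN wa; apply/holds_Imp; rewrite value_Neg value_unitV wa.
rewrite !scaled_small; [|lia..].
rewrite lerBrDr -mulrDl ler_pdivrMr ?N_gt0 // mul1r -natrD ler_nat.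
by rewrite addn1.
Qed.

Lemma holds_args_fm w (P : fm -> fm -> fm) (b : seq pterm) :
  (forall s, (s < L)%N ->
    value w (P (argV s) (fm_of_pterm (nth (PConst 0) b s))) = 1) ->
  value w (args_fm P L b) = 1.
Proof.
move=> sP; apply/holds_Conj => _ /mapP[s sL ->]; apply: sP.
by move: sL; rewrite mem_iota.
Qed.

Lemma head_arity w : size (clause_nth H (node_clause w)).1 = L.
Proof.
by have /andP[/eqP] := all_nthP ([::], [::]) H_arity _ (node_clauseP w).
Qed.

Lemma body_arity w i : (i < size (clause_nth H (node_clause w)).2)%N ->
  size (nth [::] (clause_nth H (node_clause w)).2 i) = L.
Proof.
have /andP[_ /allP bL] := all_nthP ([::], [::]) H_arity _ (node_clauseP w).
by move=> ij; apply/eqP/bL/mem_nth.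
Qed.

(** [bounded_derivable_node] supplies a successor for each body atom. All successors with the same
    [node_child] agree on unit, clock and head, as [holds_Link] demands. *)
Lemma holds_clause_fm w : value w (clause_fm L (clause_nth H (node_clause w))) = 1.
Proof.
apply/holds_And; split.
  apply: holds_args_fm => s sL; apply/holds_Iff.
  by rewrite value_argV value_pterm (nth_map (PConst 0)) // head_arity.
apply/holds_Conj => _ /mapP[i i_lt ->]; move: i_lt; rewrite mem_iota => /andP[_].
rewrite add0n => i_lt.
have wH := node_heightP w.
have [w' [w'E kE w'i]] := bounded_derivable_node i (ltnW wH) (node_bodyP i_lt).
have ww' : acc w w'.
  split; rewrite ?w'i // /node_body ?size_map //.
  by rewrite (nth_map [::]).
have w'1 : value (w' : world countermodel) (childV i) = 1.
  by rewrite value_childV w'i eqxx.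
have linkP b c :
    (forall v, acc w v -> node_child v = i -> value v b = value w c) ->
    value w (Link (childV i) b c) = 1.
  move=> bc; apply: holds_Link ww' w'1 _ => v wv; rewrite value_childV.
  by case: eqP => [vi|_]; [right; split => //; apply: bc | left].
apply/holds_And; split.
  apply/eqP; rewrite eq_le value_le1 -w'1; exact: value_Dia_ge.
apply/holds_And; split; first by apply: linkP => v _ _; rewrite !value_unitV.
apply/holds_And; split.
  apply: linkP => v [hE _ _] _.
  rewrite value_clockV (value_Incr_scaled (value_clockV w)); congr scaled.
  by rewrite hE; have := node_heightP w; lia.
apply: holds_args_fm => s sL; apply: linkP => v [_ _ vE] vi.
rewrite value_argV value_pterm vE vi /node_body (nth_map [::]) //.
by rewrite (nth_map (PConst 0)) // body_arity.
Qed.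

Lemma holds_horn_fm w :
  (forall s, s != 1%N -> nth 0%N goal s = 0%N) ->
  value w (horn_fm L H) = 1.
Proof.
move=> goal0; apply/holds_Conj => a.
have crispP (b : bool) c : value w c = b%:R -> value w (Crisp c) = 1.
  by move=> wc; apply/holds_Crisp; rewrite wc; case: b {wc}; [right|left].
rewrite !inE => /or4P[/eqP->|/eqP->|/eqP->|/or4P[/eqP->|/eqP->|/eqP->|/eqP->]].
- apply/holds_Disj; exists (clauseV (node_clause w)); last first.
    by rewrite value_clauseV eqxx.
  by apply: map_f; rewrite mem_iota; exact: node_clauseP.
- apply/holds_Conj => _ /mapP[j _ ->]; apply/holds_Imp; rewrite value_clauseV.
  case: eqP => [<-|?]; last exact: value_ge0.
  by rewrite -/(clause_nth H (node_clause w)) holds_clause_fm.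
- apply/holds_Conj => _ /mapP[i _ ->]; apply: crispP; exact: value_childV.
- apply: below_scaled (value_clockV w); have := node_heightP w; lia.
- apply/holds_Conj => _ /mapP[s sL ->]; apply: below_scaled (value_argV w s).
  move: sL; rewrite mem_iota => /andP[_ sL].
  by apply: (all_nthP 0%N (node_headP w)); rewrite size_map head_arity.
- by apply: crispP; exact: value_goalV.
- apply/holds_Conj => b /mapP[s]; rewrite mem_filter => /andP[s1 _] ->.
  apply/holds_Imp; rewrite value_goalV value_Neg value_argV.
  case: eqP => [->|?]; rewrite ?goal0 //.
    by rewrite scaled_small // mul0r subr0.
  by rewrite mulr0n subr_ge0; have /andP[] := scaled_bounds (nth 0%N (node_head w) s).
Qed.

Lemma holds_goal_fm w n : nth 0%N goal 1 = n -> value w (goal_fm n) = 1.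
Proof.
move=> gn; apply/holds_Imp; rewrite value_goalV.
case: eqP => [wE|?]; last exact: value_ge0.
suff -> : value w (Iff (argV 1) (Numeral n)) = 1 by [].
by apply/holds_Iff; rewrite value_argV value_Numeral wE gn.
Qed.

Lemma root_refutes : node_head root = goal ->
  value (root : world countermodel) refuted_fm <> 1.
Proof.
move=> rg /holds_Imp; rewrite value_goalV rg eqxx value_Neg value_unitV.
rewrite scaled_small; last exact: leq_ltn_trans (leq0n _) (node_heightP root).
have : 0 < (N%:R : R)^-1 by rewrite invr_gt0 N_gt0.
by rewrite !mulr1n mul1r; lra.
Qed.

End Countermodel.

Definition goal_atom (L n : nat) : seq nat :=
  mkseq (fun s => if s == 1 then n else 0) L.

Theorem horn_encoding (R : realType) (L n : nat) (H : seq (clause pterm)) :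
  1 < L -> all (clause_arity L) H ->
  entails R [set` [:: goal_fm n; horn_fm L H]] refuted_fm <->
  ~ derivable eval_pterm H (goal_atom L n).
Proof.
move=> L1 HL; split.
  move=> ent /derivable_bounded[m dm].
  (* The height bound [m] also serves as the denominator [N]; the root's child index 0 is
     arbitrary. *)
  have [root [rE _ _]] := @bounded_derivable_node H m m _ 0 (leqnn m) (dm m (leqnn m)).
  pose M := countermodel R (goal_atom L n) root.
  have gE s : nth 0 (goal_atom L n) s = if (s == 1) && (s < L) then n else 0.
    case: (ltnP s L) => sL; first by rewrite nth_mkseq // andbT.
    by rewrite nth_default ?size_mkseq // andbF.
  have := @root_refutes R H m _ root rE; apply; apply: (ent M) => g /=; rewrite !inE.
  case/orP=> /eqP-> w; first by apply: holds_goal_fm; rewrite gE L1.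
  by apply: holds_horn_fm => // s s1; rewrite gE (negPf s1).
move=> nd M MG w; apply: contrapT => w_ref; apply: nd.
apply: (refuted_derivable (M := M) HL _ L1 _ w_ref).
  by move=> v; apply: MG; rewrite /= !inE eqxx orbT.
by apply: MG; rewrite /= !inE eqxx.
Qed.

(** * A Horn program for consequence from a recursive set of rules *)

(** Derivations in which substitutions act on the rules of [X] but not on the premises [G]. *)
Inductive consequence (X : set rule) (G : set fm) : fm -> Prop :=
| Premise a : G a -> consequence X G a
| Instance s D a : X (D, a) ->
    (forall d, D d -> consequence X G (subst s d)) ->
    consequence X G (subst s a).

Lemma subst_id a : subst Var a = a.
Proof. by elim: a => //= [b -> c ->|b -> c ->|b -> c ->|b -> c ->|b ->|b ->|b ->]. Qed.

Lemma subst_comp s s' a :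
  subst s (subst s' a) = subst (fun p => subst s (s' p)) a.
Proof.
by elim: a => //= [b -> c ->|b -> c ->|b -> c ->|b -> c ->|b ->|b ->|b ->].
Qed.

(** [consequence] is itself a logic: cut grafts derivations onto premises, and a substitution
    composes with those of the rule instances. *)
Lemma smallest_consequence (X : set rule) G a :
  smallest is_logic X (G, a) <-> consequence X G a.
Proof.
split=> [|Ga L [[Lrefl Lcut Lsubst] XL]]; last first.
  elim: Ga => {a} [a Ga|s D a XDa _ IH]; first exact: Lrefl.
  apply: (Lcut _ (subst s @` D)); first by move=> _ [d Dd <-]; apply: IH.
  exact/Lsubst/XL.
pose L := [set r : rule | consequence X r.1 r.2].
apply: (@smallest_sub _ is_logic X L) => [|[D b] XDb]; last first.
  rewrite /L /= -(subst_id b); apply: Instance XDb _ => d Dd.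
  by rewrite subst_id; apply: Premise.
split=> [D b Db|D E b DE|s D b].
- exact: Premise.
- rewrite /L /=; elim=> {b} [b /DE //|s K b XKb _ IH].
  exact: Instance XKb IH.
- rewrite /L /=; elim=> {b} [b Db|s' K b XKb _ IH].
    by apply: Premise; exists b.
  rewrite subst_comp; apply: Instance XKb _ => d Kd.
  by rewrite -subst_comp; apply: IH.
Qed.

Lemma computes_fun n (f : recfun n) xs y y' :
  computes f xs y -> computes f xs y' -> y = y'.
Proof.
elim: f xs y y' => /= [xs y y' -> ->|xs y y' -> ->|k i xs y y' -> ->
    |k m f IHf g IHg xs y y'|m f IHf g IHg xs y y'|m f IHf xs y y'] //.
- move=> [ys gys fys] [zs gzs fzs]; have E : ys = zs.
    by apply: eq_from_tnth => i; apply: IHg (gys i) (gzs i).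
  by rewrite -E in fzs; apply: IHf fys fzs.
- move=> [h [f0 hS ->]] [h' [f0' hS' ->]].
  move: (thead xs) hS hS' => k; elim: k => [|k IHk] hS hS'.
    exact: IHf f0 f0'.
  have E : h k = h' k.
    by apply: IHk => l lk; [apply: hS | apply: hS']; apply: leqW.
  by have := hS' k (ltnSn k); rewrite -E; apply: IHg; apply: hS.
- move=> [fy lty] [fy' lty']; case: (ltngtP y y') => // lt.
    by have [u fu] := lty' _ lt; have := IHf _ _ _ fy fu.
  by have [u fu] := lty _ lt; have := IHf _ _ _ fy' fu.
Qed.

Lemma computes_seq n (f : recfun n) (xs xs' : n.-tuple nat) y :
  xs = xs' :> seq nat -> computes f xs y -> computes f xs' y.
Proof. by move/val_inj->. Qed.

Lemma computes_prec n (f : recfun n) g x (xs : n.-tuple nat) y :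
  computes (RPrec f g) [tuple of x :: xs] y <->
  exists h : nat -> nat, [/\ computes f xs (h 0),
    forall m, m < x -> computes g [tuple of m :: h m :: xs] (h m.+1) & y = h x].
Proof.
split=> -[h [h0 hS hx]]; exists h.
  rewrite theadE in hS hx; split=> // [|m lt_m]; first exact: computes_seq h0.
  exact: computes_seq (hS m lt_m).
split=> [|m|]; rewrite ?theadE //; first exact: computes_seq h0.
by move=> /hS; apply: computes_seq.
Qed.

Fixpoint code_recfun n (f : recfun n) : nat :=
  match f with
  | RZero => cpair 0 0
  | RSucc => cpair 1 0
  | RProj _ i => cpair 2 i
  | RComp k _ f g => cpair 3 (cpair (code_recfun f)
      (code_list [seq code_recfun (g i) | i <- enum 'I_k]))
  | RPrec _ f g => cpair 4 (cpair (code_recfun f) (code_recfun g))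
  | RMu _ f => cpair 5 (code_recfun f)
  end.

(* The predicate symbols are 1 for the graph of [cpair] and
   0: the diagonal goal, see [meaning];
   2: the [y]-th item of the list [x] is [z];
   3: the recursive function [x] has value [z] at the list [y];
   4: the recursive functions listed by [x] have the values [z] at [y];
   5: the recursive function [x] has nonzero values at [i :: y] for [i < z];
   6: the substitution listed by [x] turns the formula [y] into [z];
   7: the formula [y] is a consequence of the list [x];
   8: the instances of the list [z] by [y] are consequences of the list [x];
   9: the formula [Numeral x] has code [y].
   The recursive function coded by [F] decides the rules. *)
Definition program (F : nat) : seq (clause term) :=
  let C := TConst in let S := TSucc in let P := TPair in
  let K := fun a b => S (P a b) in
  let a := TVar 0 in let b := TVar 1 in let c := TVar 2 in
  let d := TVar 3 in let e := TVar 4 in let h := TVar 5 in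
  let binary := fun k =>
    ([:: C 6; a; P (C k) (P b c); P (C k) (P d e)],
     [:: [:: C 6; a; b; d]; [:: C 6; a; c; e]]) in
  let unary := fun k =>
    ([:: C 6; a; P (C k) b; P (C k) c], [:: [:: C 6; a; b; c]]) in
  let constant := fun k =>
    ([:: C 6; a; P (C k) (C 0); P (C k) (C 0)], [::]) in
  let A1 := C (code_fm (argV 1)) in
  let goal := fun t => P (C 4) (P (C (code_fm goalV))
    (P (C 1) (P (P (C 4) (P A1 t)) (P (C 4) (P t A1))))) in
  [:: ([:: C 0; P a b; C 0; C 0],
       [:: [:: C 9; P a b; c; C 0]; [:: C 7; K (goal c) a; b; C 0]]);
      ([:: C 2; K a b; C 0; a], [::]);
      ([:: C 2; K a b; S c; d], [:: [:: C 2; b; c; d]]);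
      ([:: C 3; P (C 0) (C 0); a; C 0], [::]);
      ([:: C 3; P (C 1) (C 0); K a b; S a], [::]);
      ([:: C 3; P (C 2) a; b; c], [:: [:: C 2; b; a; c]]);
      ([:: C 3; P (C 3) (P a b); c; d],
       [:: [:: C 4; b; c; e]; [:: C 3; a; e; d]]);
      ([:: C 4; C 0; a; C 0], [::]);
      ([:: C 4; K a b; c; K d e],
       [:: [:: C 3; a; c; d]; [:: C 4; b; c; e]]);
      ([:: C 3; P (C 4) (P a b); K (C 0) c; d], [:: [:: C 3; a; c; d]]);
      ([:: C 3; P (C 4) (P a b); K (S c) d; e],
       [:: [:: C 3; P (C 4) (P a b); K c d; h]; [:: C 3; b; K c (K h d); e]]);
      ([:: C 3; P (C 5) a; b; c],
       [:: [:: C 5; a; b; c]; [:: C 3; a; K c b; C 0]]);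
      ([:: C 5; a; b; C 0], [::]);
      ([:: C 5; a; b; S c], [:: [:: C 5; a; b; c]; [:: C 3; a; K c b; S d]]);
      ([:: C 6; a; P (C 0) b; c], [:: [:: C 2; a; b; c]]);
      binary 1; binary 2; binary 3; binary 4;
      unary 5; unary 8; unary 9;
      constant 6; constant 7;
      ([:: C 7; a; b; C 0], [:: [:: C 2; a; c; b]]);
      ([:: C 7; a; b; C 0],
       [:: [:: C 3; C F; K (P c d) (C 0); C 1]; [:: C 6; e; d; b];
           [:: C 8; a; e; c]]);
      ([:: C 8; a; b; C 0], [::]);
      ([:: C 8; a; b; K c d],
       [:: [:: C 6; b; c; e]; [:: C 7; a; e; C 0]; [:: C 8; a; b; d]]);
      ([:: C 9; C 0; C (code_fm Bot); C 0], [::]);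
      ([:: C 9; S a; P (C 4) (P (C (code_fm (Neg unitV))) b); C 0],
       [:: [:: C 9; a; b; C 0]])].

(** A code need not determine the arity, as projections show, so all functions with code [c] are
    covered; the claim is vacuous if none fits. *)
Definition ev_meaning (c l y : nat) : Prop :=
  forall n (f : recfun n) (xs : n.-tuple nat),
    c = code_recfun f -> to_list l = xs -> computes f xs y.

Definition list_subst (s p : nat) : fm := to_fm (nth 0 (to_list s) p).

Definition fm_set (l : nat) : set fm := [set` map to_fm (to_list l)].

(** The intended model of [program]. Predicate 0 at [x] adds [goal_fm x] to the premises of the rule
    coded by [x] itself: this is the diagonal. *)
Definition meaning (X : set rule) (atom : seq nat) : Prop :=
  if atom is [:: p; x; y; z] then
    match p with
    | 0 => consequence X
             [set` goal_fm x :: map to_fm (to_list (unpair x).1)]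
             (to_fm (unpair x).2)
    | 1 => z = cpair x y
    | 2 => y < size (to_list x) /\ nth 0 (to_list x) y = z
    | 3 => ev_meaning x y z
    | 4 => size (to_list x) = size (to_list z) /\
           forall i, i < size (to_list x) ->
             ev_meaning (nth 0 (to_list x) i) y (nth 0 (to_list z) i)
    | 5 => forall n (f : recfun n.+1) (xs : n.-tuple nat),
             x = code_recfun f -> to_list y = xs ->
             forall i, i < z -> exists u, computes f [tuple of i :: xs] u.+1
    | 6 => to_fm z = subst (list_subst x) (to_fm y)
    | 7 => consequence X (fm_set x) (to_fm y)
    | 8 => forall a, a \in map to_fm (to_list z) ->
             consequence X (fm_set x) (subst (list_subst y) a)
    | 9 => y = code_fm (Numeral x)
    | _ => False
    end
  else False.

(** The tag leaves a single constructor possible, by [cpair_inj]; the other [ev] lemmas begin in the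
    same way. *)
Lemma ev_zero l : ev_meaning (cpair 0 0) l 0.
Proof.
by move=> n f xs; case: n / f xs => [||n i|m n k g|n k g|n k] xs //= /cpair_inj[].
Qed.

Lemma ev_succ x l : ev_meaning (cpair 1 0) (cpair x l).+1 x.+1.
Proof.
move=> n f xs; case: n / f xs => [||n i|m n k g|n k g|n k] xs //= /cpair_inj[] //.
by rewrite to_listS => _ _ Exs; rewrite /thead (tnth_nth 0) -Exs.
Qed.

Lemma ev_proj i l y : i < size (to_list l) -> nth 0 (to_list l) i = y ->
  ev_meaning (cpair 2 i) l y.
Proof.
move=> _ <- n f xs; case: n / f xs => [||n j|m n k g|n k g|n k] xs //= /cpair_inj[] //.
by move=> _ -> ->; rewrite (tnth_nth 0).
Qed.

Lemma ev_comp f gs l ys y :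
  size (to_list gs) = size (to_list ys) ->
  (forall i, i < size (to_list gs) ->
     ev_meaning (nth 0 (to_list gs) i) l (nth 0 (to_list ys) i)) ->
  ev_meaning f ys y -> ev_meaning (cpair 3 (cpair f gs)) l y.
Proof.
move=> Eys gys fy n h xs.
case: n / h xs => [||n j|k n h g|n h g|n h] xs //= /cpair_inj[] //.
move=> _ /cpair_inj[Ef Eg] Exs.
move: Eys gys; rewrite Eg code_listK size_map size_enum_ord => Eys gys.
have sz : size (to_list ys) == k by rewrite Eys.
exists (Tuple sz) => [i|]; last exact: fy.
rewrite (tnth_nth 0) /=; apply: gys (ltn_ord i) _ _ _ _ Exs.
by rewrite (nth_map i) ?size_enum_ord // nth_ord_enum.
Qed.

Lemma ev_prec0 f g l y : ev_meaning f l y ->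
  ev_meaning (cpair 4 (cpair f g)) (cpair 0 l).+1 y.
Proof.
move=> fy n h xs.
case: n / h xs => [||n j|k n h h'|n h h'|n h] xs //= /cpair_inj[] //.
move=> _ /cpair_inj[Ef _]; rewrite to_listS; case/tupleP: xs => x xs [Ex El].
apply/computes_prec; exists (fun _ => y); rewrite -Ex; split=> //.
exact: fy.
Qed.

Lemma ev_precS f g m l z y :
  ev_meaning (cpair 4 (cpair f g)) (cpair m l).+1 z ->
  ev_meaning g (cpair m (cpair z l).+1).+1 y ->
  ev_meaning (cpair 4 (cpair f g)) (cpair m.+1 l).+1 y.
Proof.
move=> fz gy n h xs.
case: n / h xs => [||n j|k n h h'|n h h'|n h] xs //= /cpair_inj[] //.
move=> _ /cpair_inj[Ef Eg]; rewrite to_listS; case/tupleP: xs => x xs [Ex El].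
have : computes (RPrec h h') [tuple of m :: xs] z.
  by apply: fz; rewrite ?to_listS ?El //= Ef Eg.
case/computes_prec=> v [v0 vS Ez].
(* The values up to [m] are kept, and [y] is put at [m.+1]. *)
apply/computes_prec; exists (fun i => if i == m.+1 then y else v i).
rewrite -Ex eqxx; split=> // i.
rewrite ltnS leq_eqVlt => /orP[/eqP->|lt_im].
  rewrite !eqxx (ltn_eqF (ltnSn m)) -Ez.
  by apply: gy => //; rewrite !to_listS El.
have -> : (i == m.+1) = false by rewrite ltn_eqF // ltnW.
have -> : (i.+1 == m.+1) = false by rewrite eqSS ltn_eqF.
exact: vS.
Qed.

Lemma ev_mu f l y :
  (forall n (h : recfun n.+1) (xs : n.-tuple nat),
     f = code_recfun h -> to_list l = xs ->
     forall i, i < y -> exists u, computes h [tuple of i :: xs] u.+1) ->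
  ev_meaning f (cpair y l).+1 0 -> ev_meaning (cpair 5 f) l y.
Proof.
move=> fS f0 n h xs.
case: n / h xs => [||n j|k n h h'|n h h'|n h] xs //= /cpair_inj[] //.
move=> _ Ef Exs; split; last exact: fS Ef Exs.
by apply: f0 => //; rewrite to_listS Exs.
Qed.

(** * Soundness of the program *)

Section Soundness.
Variables (X : set rule) (f : recfun 1).
Hypothesis fX : forall n, computes f [tuple n] 1 ->
  exists s a, n = code_rule s a /\ X ([set` s], a).

Lemma fm_set_seq s : fm_set (code_seq s) = [set` s].
Proof.
by rewrite /fm_set code_seqE code_listK -map_comp (eq_map code_fmK) map_id.
Qed.

Lemma program_sound j : j < size (program (code_recfun f)) ->
  models eval_term (meaning X) (nth ([::], [::]) (program (code_recfun f)) j).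
Proof.
move=> lt_j rho.
set a := rho 0; set b := rho 1; set c := rho 2.
set d := rho 3; set e := rho 4; set h := rho 5.
case: j lt_j => [_ Hb|j].
  move: (Hb 0 isT) (Hb 1 isT) => /= -> {Hb}; rewrite cpairK /=.
  (* The pair term built in the clause computes to the code of [goal_fm]. *)
  by rewrite /fm_set to_listS /= -[cpair 4 _]/(code_fm (goal_fm (cpair a b))) code_fmK.
case: j => [_ _ /=|j]; first by rewrite to_listS.
case: j => [_ Hb|j].
  by have [] := Hb 0 isT; rewrite /= to_listS.
case: j => [_ _|j]; first exact: ev_zero.
case: j => [_ _|j]; first exact: ev_succ.
case: j => [_ Hb|j]; first by have [] := Hb 0 isT; apply: ev_proj.
case: j => [_ Hb|j].
  by have [Eys gys] := Hb 0 isT; apply: ev_comp Eys gys (Hb 1 isT).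
case: j => [_ _|j]; first by split=> //= i; rewrite to_list0.
case: j => [_ Hb|j].
  have [Eys gys] := Hb 1 isT; rewrite /= !to_listS /=; split; first by rewrite Eys.
  by move=> [_|i /gys //]; apply: (Hb 0 isT).
case: j => [_ Hb|j]; first exact: ev_prec0 (Hb 0 isT).
case: j => [_ Hb|j]; first exact: ev_precS (Hb 0 isT) (Hb 1 isT).
case: j => [_ Hb|j]; first exact: ev_mu (Hb 0 isT) (Hb 1 isT).
case: j => [_ _ //|j].
case: j => [_ Hb /= n k xs Ek Exs i|j].
  rewrite ltnS leq_eqVlt => /orP[/eqP->|]; last exact: (Hb 0 isT).
  by exists d; apply: (Hb 1 isT) => //; rewrite /= to_listS Exs.
case: j => [_ Hb|j].
  by have [_ /= Ec] := Hb 0 isT; rewrite /= to_fmE /= /list_subst Ec.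
do 4![case: j => [_ Hb|j];
  first by move: (Hb 0 isT) (Hb 1 isT) => /= Hd He;
           rewrite !to_fmE !cpairK /= Hd He].
do 3![case: j => [_ Hb|j];
  first by move: (Hb 0 isT) => /= Hc; rewrite !to_fmE /= Hc].
do 2![case: j => [_ _ /=|j]; first by rewrite !to_fmE].
case: j => [_ Hb|j].
  have [/= lt_c <-] := Hb 0 isT; apply: Premise.
  by rewrite /fm_set /=; apply/map_f/mem_nth.
case: j => [_ Hb|j].
  (* Acceptance by [f] makes [cpair c d] the code of a rule of [X], so [c] and [d] decode to its
     premises and conclusion. *)
  have [|s [a0 [Er Xs]]] := fX (n := cpair c d).
    by apply: (Hb 0 isT) => //; rewrite /= to_listS to_list0.
  have [Ec Ed] := cpair_inj Er.
  move: (Hb 1 isT) (Hb 2 isT) => /= ->; rewrite -/d Ed code_fmK => He.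
  apply: Instance Xs _ => g gs; apply: He.
  by have := fm_set_seq s; rewrite -Ec => /seteqP[_]; apply.
case: j => [_ _ /= g|j]; first by rewrite to_list0.
case: j => [_ Hb /= g|j].
  move: (Hb 0 isT) (Hb 1 isT) (Hb 2 isT) => /= Hs Hd Hl.
  by rewrite to_listS inE => /orP[/eqP->|/Hl]; rewrite // -Hs.
case: j => [_ _ //|j].
case: j => [_ Hb|j]; first by move: (Hb 0 isT) => /= ->.
by [].
Qed.

End Soundness.

(** * Completeness of the program *)

Section Completeness.
Variables (X : set rule) (f : recfun 1).
Hypothesis Xf : forall s a, X ([set` s], a) ->
  computes f [tuple code_rule s a] 1.
Hypothesis X_fin : X `<=` finitary.

Let prog := program (code_recfun f).
Let D := derivable eval_term prog.

Lemma program_clause (rho : seq nat) j a :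
  j < size prog ->
  (forall i, i < size (nth ([::], [::]) prog j).2 ->
     D (map (eval_term (nth 0 rho)) (nth [::] (nth ([::], [::]) prog j).2 i))) ->
  a = map (eval_term (nth 0 rho)) (nth ([::], [::]) prog j).1 -> D a.
Proof. exact: derivable_nth. Qed.

Lemma program_nth l i : i < size l -> D [:: 2; code_list l; i; nth 0 l i].
Proof.
elim: l i => // x l IHl [_|i lt_i].
  by apply: (@program_clause [:: x; code_list l] 1).
apply: (@program_clause [:: x; code_list l; i; nth 0 l i] 2) => // -[] //= _.
exact: IHl.
Qed.

Lemma program_ev n (k : recfun n) (xs : n.-tuple nat) y :
  computes k xs y -> D [:: 3; code_recfun k; code_list xs; y].
Proof.
elim: k xs y => /= [xs y ->|xs y ->|k i xs y ->
    |k m h IHh g IHg xs y [ys gys hys]|m h IHh g IHg xs y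
    |m h IHh xs y [h0 hS]].
- by apply: (@program_clause [:: code_list xs] 3).
- case/tupleP: xs => x xs; rewrite theadE.
  by apply: (@program_clause [:: x; code_list xs] 4).
- rewrite (tnth_nth 0).
  apply: (@program_clause [:: nat_of_ord i; code_list xs; nth 0 xs i] 5) => // -[] //= _.
  by apply: program_nth; rewrite size_tuple.
(* Generalized from [enum 'I_k] to any list, for the induction. *)
- have Dg (l : seq 'I_k) : D [:: 4; code_list [seq code_recfun (g i) | i <- l];
      code_list xs; code_list [seq tnth ys i | i <- l]].
    elim: l => [|i l IHl] /=; first by apply: (@program_clause [:: code_list xs] 7).
    apply: (@program_clause [:: code_recfun (g i);
      code_list [seq code_recfun (g i) | i <- l]; code_list xs; tnth ys i;
      code_list [seq tnth ys i | i <- l]] 8) => // -[|[]] //= _.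
    exact/IHg/gys.
  apply: (@program_clause [:: code_recfun h;
    code_list [seq code_recfun (g i) | i <- enum 'I_k];
    code_list xs; y; code_list ys] 6) => // -[|[]] //= _; last exact: IHh.
  by have := Dg (enum 'I_k); rewrite map_tnth_enum.
- case/tupleP: xs => x xs /computes_prec[v [v0 vS ->]].
  elim: x vS => [|x IHx] vS.
    apply: (@program_clause [:: code_recfun h; code_recfun g; code_list xs; v 0] 9) => //.
    by case=> //= _; apply: IHh.
  apply: (@program_clause [:: code_recfun h; code_recfun g; x; code_list xs; v x.+1;
    v x] 10) => // -[|[]] //= _.
    by apply: IHx => i lt_i; apply: vS; apply: leqW.
  by apply: (IHg [tuple of x :: v x :: xs]); apply: vS.
- have Dmu z : z <= y -> D [:: 5; code_recfun h; code_list xs; z].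
    elim: z => [_|z IHz lt_z].
      by apply: (@program_clause [:: code_recfun h; code_list xs] 12).
    have [u hu] := hS z lt_z.
    apply: (@program_clause [:: code_recfun h; code_list xs; z; u] 13) => // -[|[]] //= _.
      exact/IHz/ltnW.
    by apply: (IHh [tuple of z :: xs]).
  apply: (@program_clause [:: code_recfun h; code_list xs; y] 11) => // -[|[]] //= _.
    exact: Dmu.
  by apply: (IHh [tuple of y :: xs]).
Qed.

Fixpoint var_bound (a : fm) : nat :=
  match a with
  | Var p => p.+1
  | And b c | Or b c | Fus b c | Imp b c => maxn (var_bound b) (var_bound c)
  | Neg b | Box b | Dia b => var_bound b
  | Bot | Top => 0
  end.

Lemma program_subst s N a : var_bound a <= N ->
  D [:: 6; code_seq (mkseq s N); code_fm a; code_fm (subst s a)].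
Proof.
set l := code_seq _.
elim: a => [p|a IHa b IHb|a IHa b IHb|a IHa b IHb|a IHa b IHb|a IHa|||a IHa|a IHa] /=;
  rewrite ?geq_max.
- move=> lt_p; apply: (@program_clause [:: l; p; code_fm (s p)] 14) => // -[] //= _.
  have := @program_nth (map code_fm (mkseq s N)) p.
  by rewrite size_map size_mkseq (nth_map Bot) ?size_mkseq // nth_mkseq // -code_seqE; apply.
- case/andP=> /IHa Da /IHb Db.
  by apply: (@program_clause [:: l; code_fm a; code_fm b; code_fm (subst s a);
    code_fm (subst s b)] 15) => // -[|[]].
- case/andP=> /IHa Da /IHb Db.
  by apply: (@program_clause [:: l; code_fm a; code_fm b; code_fm (subst s a);
    code_fm (subst s b)] 16) => // -[|[]].
- case/andP=> /IHa Da /IHb Db.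
  by apply: (@program_clause [:: l; code_fm a; code_fm b; code_fm (subst s a);
    code_fm (subst s b)] 17) => // -[|[]].
- case/andP=> /IHa Da /IHb Db.
  by apply: (@program_clause [:: l; code_fm a; code_fm b; code_fm (subst s a);
    code_fm (subst s b)] 18) => // -[|[]].
- by move=> /IHa Da;
    apply: (@program_clause [:: l; code_fm a; code_fm (subst s a)] 19) => // -[].
- by move=> _; apply: (@program_clause [:: l] 22).
- by move=> _; apply: (@program_clause [:: l] 23).
- by move=> /IHa Da;
    apply: (@program_clause [:: l; code_fm a; code_fm (subst s a)] 20) => // -[].
- by move=> /IHa Da;
    apply: (@program_clause [:: l; code_fm a; code_fm (subst s a)] 21) => // -[].
Qed.

Lemma program_consequence G a :
  consequence X [set` G] a -> D [:: 7; code_seq G; code_fm a; 0].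
Proof.
elim=> {a} [a Ga|s Del a XDa _ IH].
  have lt_i : index a G < size G by rewrite index_mem.
  apply: (@program_clause [:: code_seq G; code_fm a; index a G] 24) => // -[] //= _.
  have := @program_nth (map code_fm G) (index a G).
  by rewrite size_map lt_i (nth_map Bot) // nth_index // code_seqE; apply.
have /finite_seqP[l El] : finite_set Del := X_fin XDa.
rewrite {Del}El in XDa IH.
(* Beyond all variables of the rule, so a list of the first [N] values of [s] can replace [s]. *)
pose N := maxn (var_bound a) (\max_(d <- l) var_bound d).
pose sl := code_seq (mkseq s N).
have Dl l' : {subset l' <= l} -> D [:: 8; code_seq G; sl; code_seq l'].
  elim: l' => [|d l' IHl'] sub_l /=.
    by apply: (@program_clause [:: code_seq G; sl] 26).
  have dl : d \in l by apply: sub_l; rewrite mem_head.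
  apply: (@program_clause [:: code_seq G; sl; code_fm d; code_seq l';
    code_fm (subst s d)] 27) => // -[|[|[]]] //= _.
  - apply: program_subst; rewrite leq_max; apply/orP; right.
    exact: (@leq_bigmax_seq _ l xpredT var_bound).
  - exact: IH.
  - by apply: IHl' => x xl'; apply: sub_l; rewrite inE xl' orbT.
apply: (@program_clause [:: code_seq G; code_fm (subst s a); code_seq l; code_fm a; sl]
  25) => // -[|[|[]]] //= _.
- exact: (program_ev (Xf XDa)).
- by apply: program_subst; rewrite leq_maxl.
- by apply: Dl.
Qed.

Lemma program_numeral n : D [:: 9; n; code_fm (Numeral n); 0].
Proof.
elim: n => [|n IHn]; first by apply: (@program_clause [::] 28).
by apply: (@program_clause [:: n; code_fm (Numeral n)] 29) => // -[].
Qed.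

Lemma program_diagonal s a : let n := code_rule s a in
  consequence X [set` goal_fm n :: s] a -> D [:: 0; n; 0; 0].
Proof.
move=> n /program_consequence Da.
apply: (@program_clause [:: code_seq s; code_fm a; code_fm (Numeral n)] 0) => //.
by case=> [|[]] //= _; apply: program_numeral.
Qed.

End Completeness.

(** * The diagonal argument *)

Theorem theorem4p8 (R : realType) : ~ axiomatizable (KL R).
Proof.
case=> X [X_fin [f fP] KLX].
have fX n : computes f [tuple n] 1 ->
    exists s a, n = code_rule s a /\ X ([set` s], a).
  move=> f1; apply: contrapT => /(fP n).2 f0.
  by have := computes_fun f1 f0.
have Xf s a : X ([set` s], a) -> computes f [tuple code_rule s a] 1.
  by move=> Xsa; apply: (fP _).1; exists s, a.
pose H := flat_system (program (code_recfun f)).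
(* [H] depends only on [f], so its encoding can be a premise of the rule coded by [n], while
   [goal_fm n] is added afterwards. *)
pose s := [:: horn_fm 4 H]; pose n := code_rule s refuted_fm.
have KL_consequence : KL R ([set` goal_fm n :: s], refuted_fm) <->
    consequence X [set` goal_fm n :: s] refuted_fm.
  by rewrite KLX; apply: smallest_consequence.
have KL_entails : KL R ([set` goal_fm n :: s], refuted_fm) <->
    entails R [set` goal_fm n :: s] refuted_fm.
  split=> [[G [_ /= GS ent] M MS]|ent].
    by apply: ent => g /GS; apply: MS.
  by exists [set` goal_fm n :: s]; split.
have H4 : all (clause_arity 4) H by apply: flat_system_arity.
have /(_ isT H4) enc := @horn_encoding R 4 n H.
(* A derivation would, by soundness of the program, give the entailment, which the encoding turns
   into underivability. *)
have nd : ~ derivable eval_pterm H (goal_atom 4 n).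
  move=> d; apply: (enc.1 _ d); apply/KL_entails/KL_consequence.
  have /= := flat_sound (I := meaning X) (fun _ _ _ => iff_refl _)
    (program_sound fX) d.
  rewrite (_ : unpair n = (code_seq s, code_fm refuted_fm)); last exact: cpairK.
  by rewrite code_fmK code_seqE code_listK -map_comp (eq_map code_fmK) map_id.
(* Underivability gives the entailment, hence a consequence of [X], which the program derives after
   all. *)
apply: (nd); apply: flat_complete; apply: (program_diagonal Xf X_fin).
exact/KL_consequence/KL_entails/enc.
Qed.
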